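(* Let $n\ge1$, let $\Delta\subset\mathbb{R}^n$ be an $n$-simplex with vertices $\mathbf{x}_0,\dots,\mathbf{x}_n$, and let $f\colon\Delta\to\mathbb{R}$ be convex. Then $$\operatorname{Avg}(f,\Delta)\le \frac{1}{n+1}\sum_{k=1}^{n+1}\frac{1}{\binom{n+1}{k}}\sum_{\substack{K\subset N\\ \operatorname{card}K=k}}f(\mathbf{b}_K),$$ where $N=\{0,\dots,n\}$ and $\mathbf{b}_K=\frac{1}{\operatorname{card}K}\sum_{i\in K}\mathbf{x}_i$ is the barycenter of the face $\operatorname{conv}\{\mathbf{x}_i:i\in K\}$.
   Context: $\mathbf{x}_0,\dots,\mathbf{x}_n\in\mathbb{R}^n$ are affinely independent and $\Delta=\operatorname{conv}\{\mathbf{x}_0,\dots,\mathbf{x}_n\}$. $\operatorname{Avg}(f,\Delta)=\frac{1}{\operatorname{Vol}_n(\Delta)}\int_\Delta f(\mathbf{x})\,d\mathbf{x}$ (Lebesgue measure on $\mathbb{R}^n$). *)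

(* Defs.v *)
From Stdlib Require Import Reals ClassicalEpsilon.
From HB Require Import structures.
From mathcomp Require Import all_boot.

Set Implicit Arguments.
Unset Strict Implicit.
Unset Printing Implicit Defensive.

HB.instance Definition _ :=
  Monoid.isComLaw.Build R R0 Rplus (fun a b c => esym (Rplus_assoc a b c)) Rplus_comm Rplus_0_l.


Open Scope R_scope.

Definition pt (n : nat) := 'I_n -> R.

Definition affinely_independent (n m : nat) (x : 'I_m -> pt n) : Prop :=
  forall c : 'I_m -> R,
    \big[Rplus/0]_(i < m) c i = 0 ->
    (forall j : 'I_n, \big[Rplus/0]_(i < m) (c i * x i j) = 0) ->
    forall i, c i = 0.

Definition in_conv (n m : nat) (x : 'I_m -> pt n) (y : pt n) : Prop :=
  exists lam : 'I_m -> R,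
    (forall i, 0 <= lam i) /\
    \big[Rplus/0]_(i < m) lam i = 1 /\
    (forall j : 'I_n, y j = \big[Rplus/0]_(i < m) (lam i * x i j)).

Definition convex_on (n : nat) (S : pt n -> Prop) (f : pt n -> R) : Prop :=
  forall y z : pt n, S y -> S z -> forall t : R, 0 <= t <= 1 ->
    f (fun j => t * y j + (1 - t) * z j) <= t * f y + (1 - t) * f z.

(* ---- Riemann integral over R^n (of functions supported in a box) ----
   Grid of mesh 1/m on the box [-L, L]^n: cells are indexed by
   c : {ffun 'I_n -> 'I_(2*L*m)}; cell c has j-th side
   [(c j - L m)/m, (c j - L m + 1)/m]. *)
Definition in_cell (n L m : nat) (c : {ffun 'I_n -> 'I_(2 * L * m)}) (y : pt n)
  : Prop :=
  forall j : 'I_n,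
    (INR (c j) - INR (L * m)) / INR m <= y j <=
    (INR (c j) - INR (L * m) + 1) / INR m.

Definition riemann_sum (n L m : nat) (g : pt n -> R)
  (tag : {ffun 'I_n -> 'I_(2 * L * m)} -> pt n) : R :=
  \big[Rplus/0]_(c : {ffun 'I_n -> 'I_(2 * L * m)}) (g (tag c) / (INR m ^ n)).

Definition riemann_integral (n L : nat) (g : pt n -> R) (I : R) : Prop :=
  (forall y : pt n, (exists j, INR L < Rabs (y j)) -> g y = 0) /\
  forall eps : R, 0 < eps ->
    exists m0 : nat, forall m : nat, (m0 <= m)%nat -> (0 < m)%nat ->
      forall tag : {ffun 'I_n -> 'I_(2 * L * m)} -> pt n,
        (forall c, in_cell c (tag c)) ->
        Rabs (@riemann_sum n L m g tag - I) < eps.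

Definition restrict (n : nat) (S : pt n -> Prop) (f : pt n -> R) (y : pt n) : R :=
  if excluded_middle_informative (S y) then f y else 0.

Definition barycenter (n m : nat) (x : 'I_m -> pt n) (K : {set 'I_m}) : pt n :=
  fun j => / INR #|K| * \big[Rplus/0]_(i in K) x i j.

(* Main.v *)
(** Riemann integrability: up to a function of small integral, a convex function
    on the simplex agrees with a Lipschitz function, because it is Lipschitz away
    from the boundary and thin slabs around hyperplanes have small content.

    Barycentric subdivision: each of the [(n+1)!] orderings of the vertices gives
    a flag of faces, whose barycenters span a small simplex.  On each small
    simplex Jensen's inequality bounds [f] by the interpolation of its values at
    the barycenters, and each barycentric coordinate of the small simplex has the
    mean value [1/(n+1)], since transposing two vertices preserves integrals.
    The small simplices have equal volumes for the same reason, and averaging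
    over all flags gives each face of cardinality [k] the weight
    [1 / 'C(n+1, k)].

    The invariance of the integral under the affine map permuting the vertices
    of a simplex is proved without determinants: the integral composed with this
    map is translation invariant, hence a multiple of the integral, and the
    multiple is 1 because some function of positive integral is invariant. *)
Require Import Defs.
From Stdlib Require Import Reals ZArith Lra FunctionalExtensionality.
From Stdlib Require Import Classical ClassicalEpsilon.
From HB Require Import structures.
From mathcomp Require Import all_boot all_fingroup all_algebra.
From mathcomp Require Import Rstruct zify.
From Coquelicot Require Import Coquelicot.
Set Implicit Arguments.
Unset Strict Implicit.
Unset Printing Implicit Defensive.
Open Scope R_scope.
Delimit Scope Z_scope with stdZ.

(** * Finite sums and Lipschitz functions *)

(** Discontinuous integrands enter only by comparison with Lipschitz ones, whose grid sums converge
    with an error of order [1/m]. The indicator of each small simplex is therefore replaced by a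
    product of cut-offs of width [d] in its barycentric coordinates. Such a bump is symmetric in the
    coordinates, so permuting the vertices preserves it exactly. It vanishes near the faces, so
    bumps of different flags do not overlap, and the product of [f] with their sum is Lipschitz even
    if [f] jumps at the boundary. The mean value identities hold exactly for each small [d], the
    discarded part is [O(d)], and [d] is sent to 0 only at the very end. The obstacle is the change
    of variables, since an affine map does not carry a cubic grid to a cubic grid. The way around it
    is a partition of unity by tents at the grid points: they are translates of one function and
    remain translates of one function after composition with the map, hence all have the same
    integral. That unknown integral cancels when [g] is compared with an invariant function. *)

Lemma bigR_le (I : Type) (r : seq I) (P : pred I) (F G : I -> R) :
  (forall i, P i -> F i <= G i) ->
  \big[Rplus/0]_(i <- r | P i) F i <= \big[Rplus/0]_(i <- r | P i) G i.
Proof. by move=> h; elim/big_ind2: _ => //; [lra | move=> *; lra]. Qed.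

Lemma bigR_ge0 (I : Type) (r : seq I) (P : pred I) (F : I -> R) :
  (forall i, P i -> 0 <= F i) -> 0 <= \big[Rplus/0]_(i <- r | P i) F i.
Proof. by move=> h; elim/big_ind: _ => //; [lra | move=> *; lra]. Qed.

Lemma bigR_abs (I : Type) (r : seq I) (P : pred I) (F : I -> R) :
  Rabs (\big[Rplus/0]_(i <- r | P i) F i) <=
  \big[Rplus/0]_(i <- r | P i) Rabs (F i).
Proof.
elim/big_ind2: _ => [|a b c d h1 h2|*]; first by rewrite Rabs_R0; lra.
- by apply: (Rle_trans _ _ _ (Rabs_triang _ _)); lra.
- lra.
Qed.

Lemma bigR_sub (I : Type) (r : seq I) (P : pred I) (F G : I -> R) :
  \big[Rplus/0]_(i <- r | P i) (F i - G i) =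
  \big[Rplus/0]_(i <- r | P i) F i - \big[Rplus/0]_(i <- r | P i) G i.
Proof.
by elim/big_rec3: _ => [|i a b c _ ->]; lra.
Qed.

Lemma bigR_const (I : finType) (A : {pred I}) (c : R) :
  \big[Rplus/0]_(i in A) c = INR #|A| * c.
Proof.
rewrite big_const; elim: #|A| => [|k IH]; first by rewrite /=; lra.
by rewrite iterS IH S_INR; lra.
Qed.

Lemma bigR_const_ord (n : nat) (c : R) :
  \big[Rplus/0]_(i < n) c = INR n * c.
Proof.
rewrite -[X in INR X * c]card_ord -bigR_const; exact: eq_bigl.
Qed.

Lemma bigR_term_le (I : finType) (F : I -> R) (i : I) :
  (forall k, 0 <= F k) -> F i <= \big[Rplus/0]_k F k.
Proof.
move=> h; rewrite (bigD1 i) //=.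
have : 0 <= \big[Rplus/0]_(k | k != i) F k by apply: bigR_ge0.
lra.
Qed.

Lemma bigRprod_01 (I : finType) (F : I -> R) :
  (forall i, 0 <= F i <= 1) -> 0 <= \big[Rmult/1]_i F i <= 1.
Proof.
move=> h; elim/big_ind: _ => //; first lra.
by move=> a b ? ?; nra.
Qed.

Lemma bigRprod_neq0 (I : finType) (F : I -> R) (i : I) :
  \big[Rmult/1]_i F i <> 0 -> F i <> 0.
Proof. by move=> h e; apply: h; rewrite (bigD1 i) //= e Rmult_0_l. Qed.

Lemma INR_le_ssr (a b : nat) : (a <= b)%N -> INR a <= INR b.
Proof. by move=> h; apply: le_INR; lia. Qed.

Lemma INR_gt0 (a : nat) : (0 < a)%N -> 0 < INR a.
Proof. by move=> h; apply: lt_0_INR; lia. Qed.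

Lemma INR_muln (a b : nat) : INR (a * b)%N = INR a * INR b.
Proof. exact: mult_INR. Qed.

Lemma INR_expn (a b : nat) : INR (a ^ b)%N = INR a ^ b.
Proof. by elim: b => [|b IH] //; rewrite expnS INR_muln IH. Qed.

Lemma exists_nat_gt (r : R) : exists k : nat, r < INR k.
Proof.
have [k hk] := INR_unbounded r; by exists k.
Qed.

Definition clamp (t : R) : R := Rmax 0 (Rmin 1 t).

Ltac unfold_minmax :=
  unfold clamp, Rmax, Rmin, Rabs in *;
  repeat (destruct (Rle_dec _ _) || destruct (Rcase_abs _)).

Lemma clamp_01 t : 0 <= clamp t <= 1.
Proof. unfold_minmax; lra. Qed.

Lemma clamp_lip s t : Rabs (clamp s - clamp t) <= Rabs (s - t).
Proof. unfold_minmax; lra. Qed.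

Lemma clamp_eq1 t : 1 <= t -> clamp t = 1.
Proof. move=> h; unfold_minmax; lra. Qed.

Lemma clamp_eq0 t : t <= 0 -> clamp t = 0.
Proof. move=> h; unfold_minmax; lra. Qed.

Lemma clamp_le s t : s <= t -> clamp s <= clamp t.
Proof. move=> h; unfold_minmax; lra. Qed.

Definition cube_close (n : nat) (r : R) (y z : pt n) : Prop :=
  forall j, Rabs (y j - z j) <= r.

(** The sup-norm Lipschitz condition, phrased through a bound [r] on all coordinate differences so
    that no maximum over ['I_n] is formed. *)
Definition lip_on (n : nat) (S : pt n -> Prop) (K : R) (g : pt n -> R) : Prop :=
  forall r y z, 0 <= r -> S y -> S z -> cube_close r y z ->
    Rabs (g y - g z) <= K * r.

Definition lip (n : nat) (g : pt n -> R) : Prop :=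
  exists2 K, 0 <= K & lip_on (fun _ => True) K g.

Lemma cube_close_sym n r (y z : pt n) : cube_close r y z -> cube_close r z y.
Proof. by move=> h j; rewrite Rabs_minus_sym. Qed.

Lemma lip_ext n (g h : pt n -> R) : (forall y, g y = h y) -> lip g -> lip h.
Proof. by move=> e; have -> // : g = h by apply: functional_extensionality. Qed.

Lemma lip_const n (a : R) : lip (fun _ : pt n => a).
Proof. by exists 0; [lra | move=> r y z *; rewrite Rminus_diag Rabs_R0; lra]. Qed.

Lemma lip_plus n (g h : pt n -> R) : lip g -> lip h -> lip (fun y => g y + h y).
Proof.
move=> [K K0 hK] [M M0 hM]; exists (K + M); first lra.
move=> r y z r0 _ _ c.
have -> : g y + h y - (g z + h z) = (g y - g z) + (h y - h z) by ring.
apply: (Rle_trans _ _ _ (Rabs_triang _ _)).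
have := hK r y z r0 I I c; have := hM r y z r0 I I c; lra.
Qed.

Lemma lip_comp n (phi : R -> R) (k : R) (g : pt n -> R) :
  0 <= k -> (forall s t, Rabs (phi s - phi t) <= k * Rabs (s - t)) ->
  lip g -> lip (fun y => phi (g y)).
Proof.
move=> k0 hphi [K K0 hK]; exists (k * K); first by nra.
move=> r y z r0 _ _ c; apply: (Rle_trans _ _ _ (hphi _ _)).
rewrite Rmult_assoc; apply: Rmult_le_compat_l => //; exact: hK.
Qed.

Lemma lip_scal n (a : R) (g : pt n -> R) : lip g -> lip (fun y => a * g y).
Proof.
apply: (@lip_comp n (fun t => a * t) (Rabs a)); first exact: Rabs_pos.
by move=> s t; rewrite -Rabs_mult; right; congr Rabs; ring.
Qed.

Lemma lip_sum n (I : Type) (r : seq I) (P : pred I) (F : I -> pt n -> R) :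
  (forall i, lip (F i)) -> lip (fun y => \big[Rplus/0]_(i <- r | P i) F i y).
Proof.
move=> h; elim: r => [|i r IH].
  by apply: lip_ext (lip_const n 0) => y; rewrite big_nil.
case e : (P i).
- by apply: lip_ext (lip_plus (h i) IH) => y; rewrite big_cons e.
- by apply: lip_ext IH => y; rewrite big_cons e.
Qed.

Lemma lip_coord n (j : 'I_n) : lip (fun y => y j).
Proof. by exists 1; [lra | move=> r y z r0 _ _ c; rewrite Rmult_1_l]. Qed.

(* A product is Lipschitz as soon as one factor is well behaved where the other
   one does not vanish. *)
Lemma lip_mul_supp n (u v : pt n -> R) (Ku B C : R) :
  0 <= Ku -> 0 <= B ->
  lip_on (fun y => v y <> 0) Ku u -> (forall y, v y <> 0 -> Rabs (u y) <= B) ->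
  (forall y, Rabs (v y) <= C) -> lip v -> lip (fun y => u y * v y).
Proof.
move=> Ku0 B0 hu hB hC [K K0 hK].
exists (Ku * Rabs C + B * K).
  have := Rabs_pos C; nra.
move=> r y z r0 _ _ c.
have hv := hK r y z r0 I I c.
have aC : forall y, Rabs (v y) <= Rabs C.
  by move=> t; apply: Rle_trans (hC t) (Rle_abs _).
have P0 : 0 <= Ku * Rabs C * r.
  by apply: Rmult_le_pos => //; apply: Rmult_le_pos => //; apply: Rabs_pos.
have P1 : 0 <= B * K * r by apply: Rmult_le_pos => //; apply: Rmult_le_pos.
(* If one product vanishes, the other is at most [B] times the variation of [v]; [u] is not compared
   across the zero set of [v]. *)
have key : forall y z : pt n, v z = 0 -> Rabs (v y - v z) <= K * r ->
    Rabs (u y * v y - u z * v z) <= (Ku * Rabs C + B * K) * r.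
  move=> a b e ha; rewrite e Rmult_0_r Rminus_0_r.
  case: (Req_dec (v a) 0) => ea.
    by rewrite ea Rmult_0_r Rabs_R0; lra.
  rewrite e Rminus_0_r in ha; rewrite Rabs_mult.
  have : Rabs (u a) * Rabs (v a) <= B * (K * r).
    by apply: Rmult_le_compat; try apply: Rabs_pos; [apply: hB|].
  lra.
case: (Req_dec (v z) 0) => ez; first exact: key.
case: (Req_dec (v y) 0) => ey.
  by rewrite Rabs_minus_sym; apply: key => //; rewrite Rabs_minus_sym.
have -> : u y * v y - u z * v z = (u y - u z) * v y + u z * (v y - v z) by ring.
apply: (Rle_trans _ _ _ (Rabs_triang _ _)); rewrite !Rabs_mult.
have : Rabs (u y - u z) * Rabs (v y) <= (Ku * r) * Rabs C.
  by apply: Rmult_le_compat; try apply: Rabs_pos; [apply: hu|apply: aC].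
have : Rabs (u z) * Rabs (v y - v z) <= B * (K * r).
  by apply: Rmult_le_compat; try apply: Rabs_pos; [apply: hB|].
lra.
Qed.

Lemma lip_mul_01 n (u v : pt n -> R) :
  (forall y, 0 <= u y <= 1) -> (forall y, 0 <= v y <= 1) ->
  lip u -> lip v -> lip (fun y => u y * v y).
Proof.
move=> hu hv [K K0 hK] lv.
apply: (@lip_mul_supp n u v K 1 1) => //; try lra.
- by move=> r y z r0 _ _ c; apply: hK.
- by move=> y _; rewrite Rabs_pos_eq; have := hu y; lra.
- by move=> y; rewrite Rabs_pos_eq; have := hv y; lra.
Qed.

Lemma lip_prod_01 n (I : finType) (F : I -> pt n -> R) :
  (forall i y, 0 <= F i y <= 1) -> (forall i, lip (F i)) ->
  lip (fun y => \big[Rmult/1]_i F i y).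
Proof.
move=> h01 h.
suff [] : lip (fun y => \big[Rmult/1]_i F i y) /\
   forall y, 0 <= \big[Rmult/1]_i F i y <= 1 by [].
elim: (index_enum I) => [|i r [IH IH']].
  split=> [|y]; last by rewrite big_nil; lra.
  by apply: lip_ext (lip_const n 1) => y; rewrite big_nil.
split=> [|y].
- by apply: lip_ext (lip_mul_01 (h01 i) IH' (h i) IH) => y; rewrite big_cons.
- by rewrite big_cons; have := h01 i y; have := IH' y; nra.
Qed.

Lemma lip_clamp n (g : pt n -> R) : lip g -> lip (fun y => clamp (g y)).
Proof.
apply: (@lip_comp n clamp 1); first lra.
by move=> s t; rewrite Rmult_1_l; apply: clamp_lip.
Qed.

Lemma lip_abs n (g : pt n -> R) : lip g -> lip (fun y => Rabs (g y)).
Proof.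
apply: (@lip_comp n Rabs 1); first lra.
by move=> s t; rewrite Rmult_1_l; apply: Rabs_triang_inv2.
Qed.

(** The sum of the individual constants dominates each of them, which replaces a maximum over the
    finite type. *)
Lemma common_bound (I : finType) (P : I -> R -> Prop) :
  (forall i a b, a <= b -> P i a -> P i b) ->
  (forall i, exists2 K, 0 <= K & P i K) ->
  exists2 K, 0 <= K & forall i, P i K.
Proof.
move=> mono h.
have h' i : exists K, 0 <= K /\ P i K by have [K K0 PK] := h i; exists K.
pose k i := proj1_sig (constructive_indefinite_description _ (h' i)).
have hk i : 0 <= k i /\ P i (k i) := proj2_sig (constructive_indefinite_description _ (h' i)).
exists (\big[Rplus/0]_i k i); first by apply: bigR_ge0 => i _; apply: (hk i).1.
move=> i; apply: mono (hk i).2; apply: bigR_term_le => j; exact: (hk j).1.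
Qed.

Lemma lip_pre n (g : pt n -> R) (T : pt n -> pt n) :
  lip g -> (forall j, lip (fun y => T y j)) -> lip (fun y => g (T y)).
Proof.
move=> [K K0 hK] hT.
have [M M0 hM] : exists2 M, 0 <= M &
    forall j, lip_on (fun _ => True) M (fun y => T y j).
  apply: (common_bound (P := fun j M => lip_on (fun _ => True) M (fun y => T y j)))
    => // j a b ab h r y z r0 _ _ c.
  by apply: Rle_trans (h r y z r0 I I c) _; apply: Rmult_le_compat_r.
exists (K * M); first by nra.
move=> r y z r0 _ _ c; rewrite Rmult_assoc; apply: hK => //; first by nra.
by move=> j; apply: hM.
Qed.

Lemma lip_affine n (a : R) (A : 'I_n -> R) :
  lip (fun y => a + \big[Rplus/0]_j (A j * y j)).
Proof.
apply: lip_plus; first exact: lip_const.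
by apply: lip_sum => j; apply: lip_scal; apply: lip_coord.
Qed.

(** * Riemann sums of Lipschitz functions *)

Definition corner (n L m : nat) (c : {ffun 'I_n -> 'I_(2 * L * m)}) : pt n :=
  fun j => (INR (c j) - INR (L * m)%N) / INR m.

Definition corner_sum (n L m : nat) (g : pt n -> R) : R :=
  riemann_sum g (@corner n L m).

Lemma in_cell_corner n L m (c : {ffun 'I_n -> 'I_(2 * L * m)}) :
  (0 < m)%N -> in_cell c (corner c).
Proof.
move=> m0 j; rewrite /corner; have im := Rinv_0_lt_compat _ (INR_gt0 m0).
split; first lra.
by rewrite /Rdiv; apply: Rmult_le_compat_r; lra.
Qed.

Lemma in_cell_close n L m (c : {ffun 'I_n -> 'I_(2 * L * m)}) y z :
  in_cell c y -> in_cell c z -> cube_close (/ INR m) y z.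
Proof.
move=> hy hz j; have := hy j; have := hz j.
rewrite /Rdiv !Rmult_plus_distr_r !Rmult_1_l => ? ?.
by apply: Rabs_le; lra.
Qed.

Lemma cells_volume n L m : (0 < m)%N ->
  INR #|{ffun 'I_n -> 'I_(2 * L * m)}| / INR m ^ n = (2 * INR L) ^ n.
Proof.
move=> m0; have m1 := INR_gt0 m0.
rewrite card_ffun !card_ord INR_expn !INR_muln Rpow_mult_distr (_ : INR 2 = 2) //.
field; apply: pow_nonzero; lra.
Qed.

Lemma volume_ge0 n L : 0 <= (2 * INR L) ^ n.
Proof. by apply: pow_le; have := pos_INR L; lra. Qed.

Lemma riemann_sum_le n L m (g1 g2 : pt n -> R)
    (t1 t2 : {ffun 'I_n -> 'I_(2 * L * m)} -> pt n) : (0 < m)%N ->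
  (forall c, g1 (t1 c) <= g2 (t2 c)) ->
  riemann_sum g1 t1 <= riemann_sum g2 t2.
Proof.
move=> m0 h; apply: bigR_le => c _; apply: Rmult_le_compat_r => //.
by left; apply: Rinv_0_lt_compat; apply: pow_lt; apply: INR_gt0.
Qed.

Lemma riemann_sum_sub n L m (g1 g2 : pt n -> R)
    (t : {ffun 'I_n -> 'I_(2 * L * m)} -> pt n) :
  riemann_sum (fun y => g1 y - g2 y) t = riemann_sum g1 t - riemann_sum g2 t.
Proof. by rewrite -bigR_sub; apply: eq_bigr => c _; rewrite /Rdiv; ring. Qed.

Lemma riemann_sum_abs n L m (g : pt n -> R)
    (t : {ffun 'I_n -> 'I_(2 * L * m)} -> pt n) : (0 < m)%N ->
  Rabs (riemann_sum g t) <= riemann_sum (fun y => Rabs (g y)) t.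
Proof.
move=> m0; rewrite /riemann_sum.
apply: Rle_trans; first exact: bigR_abs; apply: bigR_le => c _.
rewrite Rabs_mult; right; congr Rmult.
by apply: Rabs_pos_eq; left; apply: Rinv_0_lt_compat; apply: pow_lt; apply: INR_gt0.
Qed.

Lemma riemann_sum_diff n L m (g1 g2 : pt n -> R) (e : R)
    (t1 t2 : {ffun 'I_n -> 'I_(2 * L * m)} -> pt n) : (0 < m)%N ->
  (forall c, Rabs (g1 (t1 c) - g2 (t2 c)) <= e) ->
  Rabs (riemann_sum g1 t1 - riemann_sum g2 t2) <= (2 * INR L) ^ n * e.
Proof.
move=> m0 h; rewrite -(cells_volume n L m0) /riemann_sum -bigR_sub.
apply: Rle_trans; first exact: bigR_abs.
have -> : INR #|{ffun 'I_n -> 'I_(2 * L * m)}| / INR m ^ n * e =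
    INR #|{ffun 'I_n -> 'I_(2 * L * m)}| * (e / INR m ^ n) by rewrite /Rdiv; ring.
rewrite -bigR_const.
have p : 0 < / INR m ^ n by apply: Rinv_0_lt_compat; apply: pow_lt; apply: INR_gt0.
apply: bigR_le => c _.
rewrite /Rdiv -Rmult_minus_distr_r Rabs_mult (Rabs_pos_eq (/ _)); last lra.
apply: Rmult_le_compat_r; [lra | exact: h].
Qed.

Lemma coarse_proof (N k a : nat) : (a < N * k)%N -> (a %/ k < N)%N.
Proof. by case: k => [|k]; [rewrite muln0 | rewrite ltn_divLR]. Qed.

(** The cell of mesh [1/m] that contains a given cell of mesh [1/(m k)]: both grids start at [-L],
    so the indices are divided by [k]. *)
Definition coarse (n L m k : nat) (c : {ffun 'I_n -> 'I_(2 * L * (m * k))}) :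
    {ffun 'I_n -> 'I_(2 * L * m)} :=
  [ffun j => Ordinal (coarse_proof (leq_trans (ltn_ord (c j)) (eq_leq (mulnA _ m k))))].

Lemma card_quotient_fiber (N k b : nat) : (b < N)%N ->
  #|[pred a : 'I_(N * k) | a %/ k == b]%N| = k.
Proof.
move=> bN.
have pf (r : 'I_k) : (b * k + r < N * k)%N.
  by apply: leq_trans (leq_mul bN (leqnn k)); rewrite mulSn addnC ltn_add2r.
rewrite -[RHS](card_ord k) -(card_codom (f := fun r => Ordinal (pf r))); last first.
  by move=> r s [/addnI] /val_inj.
apply: eq_card => a; rewrite !inE; apply/eqP/codomP => [e|[r ->]] /=.
- have k0 : (0 < k)%N by case: (k) (a) => // [[i]]; rewrite muln0.
  exists (Ordinal (ltn_pmod a k0)); apply: val_inj => /=.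
  by rewrite -e -divn_eq.
- by rewrite divnMDl ?divn_small ?addn0 //; apply: leq_ltn_trans (ltn_ord r).
Qed.

Lemma card_coarse_fiber n L m k (c : {ffun 'I_n -> 'I_(2 * L * m)}) :
  #|[pred c' | @coarse n L m k c' == c]| = (k ^ n)%N.
Proof.
rewrite -[n in RHS]card_ord -prod_nat_const.
transitivity #|family (fun j : 'I_n => [pred a : 'I_(2 * L * (m * k)) | a %/ k == c j]%N)|.
  apply: eq_card => c'; rewrite !inE; apply/eqP/familyP => [<- j|h].
  - by rewrite !inE ffunE.
  - apply/ffunP => j; apply: val_inj; rewrite ffunE /=; apply/eqP.
    by have := h j; rewrite !inE.
rewrite card_family foldrE big_map big_enum /=; apply: eq_bigr => j _.
by rewrite mulnA card_quotient_fiber.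
Qed.

(** Each coarse cell splits into [k ^ n] fine ones, and the weights match:
    [k ^ n / (m k) ^ n = 1 / m ^ n]. *)
Lemma cell_sum_refine n L m k (F : {ffun 'I_n -> 'I_(2 * L * m)} -> R) :
  (0 < k)%N ->
  \big[Rplus/0]_c (F c / INR m ^ n) =
  \big[Rplus/0]_(c : {ffun 'I_n -> 'I_(2 * L * (m * k))})
     (F (coarse c) / INR (m * k)%N ^ n).
Proof.
move=> k0; rewrite [RHS](partition_big (@coarse n L m k) xpredT) //=.
apply: eq_bigr => c _.
transitivity (\big[Rplus/0]_(i in [pred c' | @coarse n L m k c' == c])
    (F c / INR (m * k)%N ^ n)); last first.
  by apply: eq_big => // i /eqP ->.
rewrite bigR_const card_coarse_fiber INR_expn INR_muln Rpow_mult_distr.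
have k1 : INR k ^ n <> 0 by apply: pow_nonzero; have := INR_gt0 k0; lra.
rewrite /Rdiv Rinv_mult -[LHS]Rmult_1_r -(Rinv_r _ k1); ring.
Qed.

Lemma in_cell_coarse n L m k (c : {ffun 'I_n -> 'I_(2 * L * (m * k))}) y :
  (0 < m)%N -> (0 < k)%N -> in_cell c y -> in_cell (coarse c) y.
Proof.
move=> m0 k0 h j; have := h j; rewrite /coarse ffunE /=.
set a := (c j : nat); have m1 := INR_gt0 m0; have k1 := INR_gt0 k0.
have e : INR a = INR (a %/ k) * INR k + INR (a %% k).
  by rewrite -INR_muln -plus_INR {1}(divn_eq a k).
have r0 := pos_INR (a %% k).
have r1 : INR (a %% k) + 1 <= INR k.
  by rewrite -S_INR; apply: INR_le_ssr; apply: ltn_pmod.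
rewrite mulnA INR_muln (INR_muln m) => -[h1 h2]; split.
- apply: Rle_trans h1; apply: (Rmult_le_reg_r (INR m * INR k)); first by nra.
  field_simplify; nra.
- apply: Rle_trans h2 _; apply: (Rmult_le_reg_r (INR m * INR k)); first by nra.
  field_simplify; nra.
Qed.

Lemma lip_refine n L m k M (g : pt n -> R) (K : R)
    (t : {ffun 'I_n -> 'I_(2 * L * m)} -> pt n) : (0 < m)%N -> (0 < k)%N ->
  M = (m * k)%N -> lip_on (fun _ => True) K g -> (forall c, in_cell c (t c)) ->
  Rabs (riemann_sum g t - corner_sum L M g) <= (2 * INR L) ^ n * (K * / INR m).
Proof.
move=> m0 k0 -> hK ht; rewrite {1}/riemann_sum (cell_sum_refine (fun c => g (t c)) k0).
apply: (@riemann_sum_diff n L (m * k) g g _ (fun c => t (coarse c))); first by rewrite muln_gt0 m0.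
move=> c; apply: hK => //; first by left; apply/Rinv_0_lt_compat/INR_gt0.
apply: in_cell_close (ht _) _; apply: in_cell_coarse => //.
by apply: in_cell_corner; rewrite muln_gt0 m0.
Qed.

(** A total function, so that integrals can be written without a convergence proof; it is meaningful
    once the corner sums converge, as they do for Lipschitz functions. *)
Definition integ (n L : nat) (g : pt n -> R) : R :=
  real (Lim_seq (fun m => corner_sum L m g)).

(** Both sums are compared with the corner sum on the common refinement of mesh [1/(m m')]. *)
Lemma lip_sum_dist n L m m' (g : pt n -> R) (K : R)
    (t : {ffun 'I_n -> 'I_(2 * L * m)} -> pt n) : (0 < m)%N -> (0 < m')%N ->
  lip_on (fun _ => True) K g -> (forall c, in_cell c (t c)) ->
  Rabs (riemann_sum g t - corner_sum L m' g) <=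
  (2 * INR L) ^ n * K * (/ INR m + / INR m').
Proof.
move=> m0 m'0 hK ht.
have h1 := lip_refine m0 m'0 erefl hK ht.
have h2 := lip_refine m'0 m0 (mulnC m m') hK (fun c => @in_cell_corner n L m' c m'0).
rewrite Rabs_minus_sym in h2.
have -> : riemann_sum g t - corner_sum L m' g =
  (riemann_sum g t - corner_sum L (m * m') g) + (corner_sum L (m * m') g - corner_sum L m' g) by ring.
apply: Rle_trans (Rabs_triang _ _) _; rewrite /corner_sum in h1 h2 *; lra.
Qed.

Lemma inv_INR_small (C e : R) : 0 <= C -> 0 < e ->
  exists2 m0 : nat, (0 < m0)%N & forall m, (m0 <= m)%N -> C * / INR m < e.
Proof.
move=> C0 e0; have [k hk] := exists_nat_gt (C / e).
exists k.+1 => // m hm.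
have h := INR_le_ssr hm; rewrite S_INR in h.
have ek : C < INR k * e by apply: (Rmult_lt_reg_r (/ e)); [exact: Rinv_0_lt_compat | field_simplify; lra].
have km : 0 < INR m by have := pos_INR k; lra.
apply: (Rmult_lt_reg_r (INR m)) => //; field_simplify; nra.
Qed.

Lemma lip_integ n L (g : pt n -> R) (K : R) : 0 <= K ->
  lip_on (fun _ => True) K g ->
  is_lim_seq (fun m => corner_sum L m g) (integ L g) /\
  forall m (t : {ffun 'I_n -> 'I_(2 * L * m)} -> pt n), (0 < m)%N ->
    (forall c, in_cell c (t c)) ->
    Rabs (riemann_sum g t - integ L g) <= (2 * INR L) ^ n * K * / INR m.
Proof.
move=> K0 hK; have V0 := volume_ge0 n L.
have C0 : 0 <= (2 * INR L) ^ n * K by nra.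
have cv : is_lim_seq (fun m => corner_sum L m g) (integ L g).
  apply: Lim_seq_correct'; apply/ex_lim_seq_cauchy_corr => eps.
  have [m0 m00 hm0] := inv_INR_small C0 (is_pos_div_2 eps).
  exists m0 => a b /leP ha /leP hb.
  apply: Rle_lt_trans (lip_sum_dist _ _ hK _) _; try lia.
    by move=> c; apply: in_cell_corner; lia.
  have := hm0 a ha; have := hm0 b hb => /=; lra.
split=> // m t m0 ht; apply: le_epsilon => eps eps0.
have e2 : 0 < eps / 2 by lra.
have [m1 m10 hm1] := inv_INR_small C0 e2.
have [m2 hm2] := (is_lim_seq_spec _ _).2 cv (mkposreal _ e2).
have := hm2 (maxn m1 m2) ltac:(lia); have := hm1 (maxn m1 m2) ltac:(lia).
have := lip_sum_dist m0 (_ : 0 < maxn m1 m2)%N hK ht => /(_ ltac:(lia)).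
set x := riemann_sum g t; set y := corner_sum L _ g; move=> /= h1 h2 h3.
have -> : x - integ L g = (x - y) + (y - integ L g) by ring.
apply: Rle_trans (Rabs_triang _ _) _; lra.
Qed.

Lemma lip_cv n L (g : pt n -> R) : lip g ->
  is_lim_seq (fun m => corner_sum L m g) (integ L g).
Proof. by move=> [K K0 hK]; apply: (lip_integ L K0 hK).1. Qed.
Arguments lip_cv {n} L {g} _.

(** * The integral of Lipschitz functions *)

Lemma integ_unique n L (g : pt n -> R) (l : R) : 
  is_lim_seq (fun m => corner_sum L m g) l -> integ L g = l.
Proof. by move=> h; rewrite /integ (is_lim_seq_unique _ _ h). Qed.

Lemma integ_ext n L (g h : pt n -> R) :
  (forall y, g y = h y) -> integ L g = integ L h.
Proof. by move=> e; have -> : g = h by apply: functional_extensionality. Qed.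

Lemma integ_plus n L (g h : pt n -> R) : lip g -> lip h ->
  integ L (fun y => g y + h y) = integ L g + integ L h.
Proof.
move=> lg lh; apply: integ_unique.
refine (is_lim_seq_ext _ _ _ _ (is_lim_seq_plus' _ _ _ _ (lip_cv L lg) (lip_cv L lh))) => m.
rewrite /corner_sum /riemann_sum -big_split /=; apply: eq_bigr => c _.
by rewrite /Rdiv; ring.
Qed.

Lemma integ_scal n L (a : R) (g : pt n -> R) : lip g ->
  integ L (fun y => a * g y) = a * integ L g.
Proof.
move=> lg; apply: integ_unique.
refine (is_lim_seq_ext _ _ _ _ (is_lim_seq_scal_l _ a _ (lip_cv L lg))) => m.
rewrite /corner_sum /riemann_sum big_distrr /=; apply: eq_bigr => c _.
by rewrite /Rdiv; ring.
Qed.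

Lemma corner_sum_const n L m (a : R) : (0 < m)%N ->
  corner_sum L m (fun _ : pt n => a) = (2 * INR L) ^ n * a.
Proof.
move=> m0; rewrite -(cells_volume n L m0) /corner_sum /riemann_sum.
rewrite (bigR_const {: {ffun 'I_n -> 'I_(2 * L * m)}}) /Rdiv.
set X := INR _; set Y := INR _.
ring.
Qed.

Lemma lim_seq_pos (u : nat -> R) (v : nat -> R) (l : Rbar) :
  (forall m, (0 < m)%N -> u m = v m) -> is_lim_seq u l -> is_lim_seq v l.
Proof.
move=> h; apply: is_lim_seq_ext_loc; exists 1%nat => m hm.
by apply: h; lia.
Qed.

Lemma lim_seq_pos_le (u v : nat -> R) (a b : R) :
  (forall m, (0 < m)%N -> u m <= v m) -> is_lim_seq u a -> is_lim_seq v b ->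
  a <= b.
Proof.
move=> h; apply: (is_lim_seq_le_loc u v a b); exists 1%nat => m hm.
by apply: h; lia.
Qed.

Lemma integ_const n L (a : R) :
  integ L (fun _ : pt n => a) = (2 * INR L) ^ n * a.
Proof.
apply: integ_unique; refine (lim_seq_pos _ (is_lim_seq_const _)) => m m0.
by rewrite corner_sum_const.
Qed.

Lemma integ_sum n L (I : Type) (r : seq I) (P : pred I) (F : I -> pt n -> R) :
  (forall i, lip (F i)) ->
  integ L (fun y => \big[Rplus/0]_(i <- r | P i) F i y) =
  \big[Rplus/0]_(i <- r | P i) integ L (F i).
Proof.
move=> h; elim: r => [|i r IH].
  rewrite big_nil -[RHS](Rmult_0_r ((2 * INR L) ^ n)) -integ_const.
  by apply: integ_ext => y; rewrite big_nil.
rewrite big_cons -IH; case e : (P i).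
- rewrite -integ_plus //; last exact: lip_sum.
  by apply: integ_ext => y; rewrite big_cons e.
- by apply: integ_ext => y; rewrite big_cons e.
Qed.

Lemma integ_le n L (g h : pt n -> R) : lip g -> lip h ->
  (forall y, g y <= h y) -> integ L g <= integ L h.
Proof.
move=> lg lh le; refine (lim_seq_pos_le _ (lip_cv L lg) (lip_cv L lh)) => m m0.
exact: riemann_sum_le.
Qed.

Lemma integ_dist n L (g h : pt n -> R) (e : R) : lip g -> lip h ->
  (forall y, Rabs (g y - h y) <= e) ->
  Rabs (integ L g - integ L h) <= (2 * INR L) ^ n * e.
Proof.
move=> lg lh le; have lc := lip_const n e.
have h1 : integ L g <= integ L h + (2 * INR L) ^ n * e.
  rewrite -integ_const -integ_plus //; apply: integ_le => //; first exact: lip_plus.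
  by move=> y; have := Rle_abs (g y - h y); have := le y; lra.
have h2 : integ L h <= integ L g + (2 * INR L) ^ n * e.
  rewrite -integ_const -integ_plus //; apply: integ_le => //; first exact: lip_plus.
  move=> y; have := Rle_abs (h y - g y); rewrite Rabs_minus_sym; have := le y; lra.
by apply: Rabs_le; lra.
Qed.

Lemma in_cell_exists n L m (z : pt n) : (0 < m)%N ->
  (forall j, Rabs (z j) < INR L) ->
  exists c : {ffun 'I_n -> 'I_(2 * L * m)}, in_cell c z.
Proof.
move=> m0 hz; have m1 := INR_gt0 m0.
have h j : exists a : 'I_(2 * L * m),
    (INR a - INR (L * m)) / INR m <= z j <= (INR a - INR (L * m) + 1) / INR m.
  have [z1 z2] := Rabs_def2 _ _ (hz j).
  have p0 : 0 <= INR m * (z j + INR L) by apply: Rmult_le_pos; lra.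
  have [a [a1 a2]] := nfloor_ex _ p0.
  have aN : (a < 2 * L * m)%N.
    apply/ltP; apply: INR_lt; rewrite !INR_muln (_ : INR 2 = 2) //.
    by apply: Rle_lt_trans a1 _; nra.
  exists (Ordinal aN); rewrite /= INR_muln; split.
  - apply: (Rmult_le_reg_r (INR m)) => //; field_simplify; lra.
  - apply: (Rmult_le_reg_r (INR m)) => //; field_simplify; lra.
pose c := [ffun j => proj1_sig (constructive_indefinite_description _ (h j))].
by exists c => j; rewrite ffunE; case: constructive_indefinite_description.
Qed.

(** On a cell of mesh [1/m] around [z], with [K/m] below [g z / 2], the function stays above
    [g z / 2]; this cell alone gives a positive lower bound. *)
Lemma integ_gt0 n L (g : pt n -> R) (z : pt n) : lip g ->
  (forall y, 0 <= g y) -> (forall j, Rabs (z j) < INR L) -> 0 < g z ->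
  0 < integ L g.
Proof.
move=> lg g0 hz gz; case: (lg) => K K0 hK.
have gz2 : 0 < g z / 2 by lra.
have [m m0 hm] := inv_INR_small K0 gz2.
have {}hm := hm m (leqnn m).
have [c hc] := in_cell_exists m0 hz.
have m1 := INR_gt0 m0; have p := pow_lt _ n m1.
suff : g z / 2 * / INR m ^ n <= integ L g.
  apply: Rlt_le_trans; apply: Rmult_lt_0_compat; first lra.
  exact: Rinv_0_lt_compat.
(* Only multiples of [m] are used, so that the chosen cell is a union of finer cells. *)
have sub : is_lim_seq (fun k => corner_sum L (m * k) g) (integ L g).
  refine (is_lim_seq_subseq (fun m => corner_sum L m g) _ _ _ (lip_cv L lg)).
  apply: eventually_subseq_loc; exists 0%nat => k _; nia.
refine (lim_seq_pos_le _ (is_lim_seq_const _) sub) => k k0.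
pose F (c' : {ffun 'I_n -> 'I_(2 * L * m)}) := if c' == c then g z / 2 else 0.
have <- : \big[Rplus/0]_c' (F c' / INR m ^ n) = g z / 2 * / INR m ^ n.
  rewrite (bigD1 c) //= /F eqxx big1 ?Rplus_0_r // => i /negbTE ->.
  by rewrite /Rdiv Rmult_0_l.
rewrite (cell_sum_refine _ k0); apply: bigR_le => c' _.
have q : 0 < / INR (m * k)%N ^ n.
  by apply/Rinv_0_lt_compat/pow_lt/INR_gt0; rewrite muln_gt0 m0.
apply: Rmult_le_compat_r; first lra.
rewrite /F; case: eqP => // e.
have hc' : in_cell c (corner c').
  by rewrite -e; apply: in_cell_coarse => //; apply: in_cell_corner; rewrite muln_gt0 m0.
have := hK _ _ _ (Rlt_le _ _ (Rinv_0_lt_compat _ m1)) I I (in_cell_close hc hc').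
by move/(Rle_trans _ _ _ (Rle_abs _)); lra.
Qed.

Definition riemann_cv (n L : nat) (g : pt n -> R) (v : R) : Prop :=
  forall eps : R, 0 < eps ->
    exists m0 : nat, forall m : nat, (m0 <= m)%nat -> (0 < m)%nat ->
      forall tag : {ffun 'I_n -> 'I_(2 * L * m)} -> pt n,
        (forall c, in_cell c (tag c)) ->
        Rabs (@riemann_sum n L m g tag - v) < eps.

Lemma lip_riemann_cv n L (g : pt n -> R) : lip g -> riemann_cv L g (integ L g).
Proof.
move=> [K K0 hK] eps eps0.
have [|m0 _ hm] := inv_INR_small (_ : 0 <= (2 * INR L) ^ n * K) eps0.
  by have := volume_ge0 n L; nra.
exists m0 => m h1 h2 t ht; apply: Rle_lt_trans (hm m h1).
exact: (lip_integ L K0 hK).2.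
Qed.

Lemma riemann_cv_corner n L (g : pt n -> R) (v : R) :
  riemann_cv L g v -> is_lim_seq (fun m => corner_sum L m g) v.
Proof.
move=> h; apply/is_lim_seq_spec => eps.
have [m0 hm] := h eps (cond_pos eps); exists (maxn 1 m0) => m hm'.
by apply: hm; try lia; move=> c; apply: in_cell_corner; lia.
Qed.

(** Sums of [g] and [u] with the same tags differ by at most the sum of [psi]. The three thirds of
    [eps] pay for the integral of [psi] and for the convergence of the sums of [psi] and of [u]. *)
Lemma sandwich_integrable n L (g : pt n -> R) :
  (forall eps, 0 < eps -> exists u psi : pt n -> R,
     [/\ lip u, lip psi, forall y, Rabs (g y - u y) <= psi y
       & integ L psi <= eps]) ->
  exists v, riemann_cv L g v.
Proof.
move=> h.
have key eps : 0 < eps -> exists v, exists m0 : nat, forall m : nat,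
    (m0 <= m)%nat -> (0 < m)%nat ->
    forall t : {ffun 'I_n -> 'I_(2 * L * m)} -> pt n,
      (forall c, in_cell c (t c)) -> Rabs (riemann_sum g t - v) < eps.
  move=> eps0; have [|u [psi [lu lpsi le hpsi]]] := h (eps / 3); first lra.
  have [|m1 hm1] := lip_riemann_cv L lu (eps := eps / 3); first lra.
  have [|m2 hm2] := lip_riemann_cv L lpsi (eps := eps / 3); first lra.
  exists (integ L u), (maxn m1 m2) => m hm m0 t ht.
  have h1 := hm1 m ltac:(lia) m0 t ht.
  have h2 := hm2 m ltac:(lia) m0 t ht.
  have h3 : Rabs (riemann_sum g t - riemann_sum u t) <= riemann_sum psi t.
    rewrite -riemann_sum_sub; apply: Rle_trans (riemann_sum_abs _ _ m0) _.
    exact: riemann_sum_le.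
  have := Rabs_def2 _ _ h1; have := Rabs_def2 _ _ h2.
  have := Rle_abs (riemann_sum g t - riemann_sum u t).
  have := Rle_abs (- (riemann_sum g t - riemann_sum u t)).
  by rewrite Rabs_Ropp => *; apply: Rabs_def1; lra.
(* The value supplied by [key] depends on [eps]; a single one is obtained as the limit of the corner
   sums, which are Cauchy. *)
have [v hv] : ex_finite_lim_seq (fun m => corner_sum L m g).
  apply/ex_lim_seq_cauchy_corr => eps.
  have [w [m0 hm]] := key _ (is_pos_div_2 eps).
  exists (maxn 1 m0) => a b ha hb.
  have cor m : (maxn 1 m0 <= m)%coq_nat -> forall c : {ffun 'I_n -> 'I_(2 * L * m)}, in_cell c (corner c).
    by move=> hm1 c; apply: in_cell_corner; lia.
  have := Rabs_def2 _ _ (hm a ltac:(lia) ltac:(lia) (@corner n L a) (cor a ha)).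
  have := Rabs_def2 _ _ (hm b ltac:(lia) ltac:(lia) (@corner n L b) (cor b hb)).
  by rewrite /corner_sum /= => ? ?; apply: Rabs_def1; lra.
exists v => eps eps0; have e3 : 0 < eps / 3 by lra.
have [w [m0 hm]] := key _ e3.
have [m1 hm1] := (is_lim_seq_spec _ _).2 hv (mkposreal _ e3).
exists m0 => m h0 m_gt0 t ht.
pose M := maxn 1 (maxn m0 m1).
have cor (c : {ffun 'I_n -> 'I_(2 * L * M)}) : in_cell c (corner c).
  by apply: in_cell_corner; lia.
have := Rabs_def2 _ _ (hm m h0 m_gt0 t ht).
have := Rabs_def2 _ _ (hm M ltac:(lia) ltac:(lia) _ cor).
have := Rabs_def2 _ _ (hm1 M ltac:(lia)).
by rewrite /corner_sum /= => *; apply: Rabs_def1; lra.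
Qed.

Lemma riemann_cv_dist n L (g u psi : pt n -> R) (v : R) :
  riemann_cv L g v -> lip u -> lip psi ->
  (forall y, Rabs (g y - u y) <= psi y) ->
  Rabs (v - integ L u) <= integ L psi.
Proof.
move=> hv lu lpsi le.
have c := is_lim_seq_minus' _ _ _ _ (riemann_cv_corner hv) (lip_cv L lu).
refine (lim_seq_pos_le _ (is_lim_seq_abs _ _ c) (lip_cv L lpsi)) => m m0.
rewrite -riemann_sum_sub; apply: Rle_trans (riemann_sum_abs _ _ m0) _.
exact: riemann_sum_le.
Qed.

(** * Slabs and translations *)

Lemma lim_seq_loc_le (u v : nat -> R) (m0 : nat) (a b : R) :
  (forall m, (m0 <= m)%N -> (0 < m)%N -> u m <= v m) ->
  is_lim_seq u a -> is_lim_seq v b -> a <= b.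
Proof.
move=> h; apply: (is_lim_seq_le_loc u v a b); exists (maxn 1 m0) => m hm.
by apply: h; lia.
Qed.

Lemma lim_inv_INR (C : R) : 0 <= C -> is_lim_seq (fun m => C * / INR m) 0.
Proof.
move=> C0; apply/is_lim_seq_spec => eps.
have [m0 m00 hm] := inv_INR_small C0 (cond_pos eps).
exists m0 => m /leP h; rewrite Rminus_0_r Rabs_pos_eq; first exact: hm.
by apply: Rmult_le_pos => //; left; apply/Rinv_0_lt_compat/INR_gt0; lia.
Qed.

Lemma card_ord_lt (N w : nat) : (#|[pred a : 'I_N | (a < w)%N]| <= w)%N.
Proof.
case: w => [|w]; first by rewrite eq_card0.
rewrite -[X in (_ <= X)%N]card_ord.
apply: (@leq_card_in _ _ (fun a : 'I_N => inord a : 'I_w.+1)).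
move=> a b; rewrite !inE => ha hb /(congr1 val) /=.
by rewrite !inordK // => /val_inj.
Qed.

(* Reducing the [j0]-coordinate mod [w] is injective on [P]. *)
Lemma card_line_bound (n N w : nat) (j0 : 'I_n) (P : pred {ffun 'I_n -> 'I_N}) :
  (0 < w)%N ->
  (forall c c', P c -> P c' -> (forall j, j != j0 -> c j = c' j) ->
     (c j0 %% w = c' j0 %% w)%N -> c j0 = c' j0) ->
  (#|P| <= w * N ^ n.-1)%N.
Proof.
move=> w0 h.
have pf (a : 'I_N) : (a %% w < N)%N by apply: leq_ltn_trans (leq_mod _ _) (ltn_ord a).
pose f (c : {ffun 'I_n -> 'I_N}) : {ffun 'I_n -> 'I_N} :=
  [ffun j => if j == j0 then Ordinal (pf (c j)) else c j].
have f_inj : {in P &, injective f}.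
  move=> c c' Pc Pc' /ffunP e.
  have e1 j : j != j0 -> c j = c' j.
    by move=> /negbTE hj; have := e j; rewrite !ffunE hj.
  have e2 : c j0 = c' j0.
    by apply: h => //; have := congr1 val (e j0); rewrite !ffunE eqxx.
  by apply/ffunP => j; case: (eqVneq j j0) => [->|/e1].
rewrite -(card_in_image f_inj).
apply: (@leq_trans #|family (fun j : 'I_n => if j == j0 then [pred a : 'I_N | (a < w)%N] else predT)|).
  apply: subset_leq_card; apply/subsetP => _ /imageP[c _ ->].
  apply/familyP => j; rewrite /f ffunE; case: eqP => // _.
  by rewrite inE /= ltn_mod.
rewrite card_family foldrE big_map big_enum /= (bigD1 j0) //= eqxx.
apply: leq_mul; first exact: card_ord_lt.
rewrite (eq_bigr (fun=> N)) => [|j /negbTE ->]; last by rewrite card_ord.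
by rewrite prod_nat_const cardC1 card_ord.
Qed.

(** For [d > 0] this is 1 when [|t| <= 2d] and 0 when [|t| >= 4d]. The plateau covers the range in
    which a coordinate is too small for its bump to be 1. *)
Definition slab (d t : R) : R := clamp (2 - Rabs t / (2 * d)).

Lemma lip_slab n (d : R) (g : pt n -> R) : lip g -> lip (fun y => slab d (g y)).
Proof.
move=> lg; apply: lip_clamp; apply: lip_plus; first exact: lip_const.
apply: lip_ext (lip_scal (- / (2 * d)) (lip_abs lg)) => y.
by rewrite /Rdiv; ring.
Qed.

(** On a line parallel to axis [j0], two corners where the slab is nonzero have values of the affine
    form less than [8d] apart, so their indices differ by less than [8 d m / |A j0|]. The remaining
    [n - 1] indices are free. *)
Lemma integ_slab n L (a : R) (A : 'I_n -> R) (j0 : 'I_n) (d : R) :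
  A j0 <> 0 -> 0 < d ->
  integ L (fun y => slab d (a + \big[Rplus/0]_j (A j * y j))) <=
  (2 * INR L) ^ n.-1 * (8 / Rabs (A j0)) * d.
Proof.
move=> hA d0; have A0 := Rabs_pos_lt _ hA.
pose l (y : pt n) := a + \big[Rplus/0]_j (A j * y j).
have V0 := volume_ge0 n.-1 L.
(* The extra term in [/ INR m] pays for rounding the number of cells per line up to an integer. *)
have cv : is_lim_seq (fun m => (2 * INR L) ^ n.-1 * (8 / Rabs (A j0)) * d +
    (2 * INR L) ^ n.-1 * / INR m) ((2 * INR L) ^ n.-1 * (8 / Rabs (A j0)) * d + 0).
  exact: (is_lim_seq_plus' _ _ _ _ (is_lim_seq_const _) (lim_inv_INR V0)).
rewrite -[X in _ <= X]Rplus_0_r.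
refine (lim_seq_pos_le _ (lip_cv L (lip_slab d (lip_affine a A))) cv) => m m0.
have m1 := INR_gt0 m0.
pose P : pred {ffun 'I_n -> 'I_(2 * L * m)} := [pred c | slab d (l (corner c)) != 0].
apply: (@Rle_trans _ (INR #|P| * / INR m ^ n)).
  rewrite /corner_sum /riemann_sum -bigR_const [X in _ <= X]big_mkcond.
  have p : 0 < / INR m ^ n by apply/Rinv_0_lt_compat/pow_lt.
  apply: bigR_le => c _; rewrite inE /P /=.
  case: eqP => /= [e|_]; first by rewrite -/(l _) e; lra.
  have := clamp_01 (2 - Rabs (l (corner c)) / (2 * d)).
  rewrite -/(slab _ _) /Rdiv -/(l _); nra.
have x0 : 0 <= 8 * d * INR m / Rabs (A j0).
  by apply: Rmult_le_pos; [nra | left; apply: Rinv_0_lt_compat].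
have [w' [w1 w2]] := nfloor_ex _ x0.
(* Two indices at distance less than [w'.+1] with the same residue modulo [w'.+1] are equal. *)
have cardP : (#|P| <= w'.+1 * (2 * L * m) ^ n.-1)%N.
  apply: (card_line_bound (j0 := j0)) => // c c'; rewrite /P !inE => /eqP hc /eqP hc' agree emod.
  have small y : slab d (l y) <> 0 -> Rabs (l y) < 4 * d.
    move=> hy; apply: Rnot_le_lt => hle; apply: hy; apply: clamp_eq0.
    have : Rabs (l y) * / (2 * d) >= 4 * d * / (2 * d).
      by apply: Rle_ge; apply: Rmult_le_compat_r => //; left; apply: Rinv_0_lt_compat; lra.
    have -> : 4 * d * / (2 * d) = 2 by field; lra.
    by rewrite /Rdiv; lra.
  have dl : l (corner c) - l (corner c') = A j0 * ((INR (c j0) - INR (c' j0)) / INR m).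
    rewrite /l (bigD1 j0) //= [X in _ - (_ + X)](bigD1 j0) //=.
    rewrite (eq_bigr (fun j => A j * corner c' j)) => [|j /agree e].
      by rewrite /corner; field; lra.
    by rewrite /corner e.
  have bound : Rabs (INR (c j0) - INR (c' j0)) < INR w'.+1.
    rewrite S_INR; apply: Rlt_trans w2.
    have := small _ hc; have := small _ hc'.
    have : Rabs (A j0 * ((INR (c j0) - INR (c' j0)) / INR m)) <= Rabs (l (corner c)) + Rabs (l (corner c')).
      rewrite -dl -(Rabs_Ropp (l (corner c'))); exact: Rabs_triang.
    rewrite Rabs_mult /Rdiv Rabs_mult (Rabs_pos_eq (/ INR m)); last by left; apply: Rinv_0_lt_compat.
    set D := Rabs (_ - _) => h1 h2 h3.
    apply: (Rmult_lt_reg_r (Rabs (A j0) * / INR m)).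
      by apply: Rmult_lt_0_compat => //; apply: Rinv_0_lt_compat.
    have -> : 8 * d * INR m * / Rabs (A j0) * (Rabs (A j0) * / INR m) = 8 * d by field; lra.
    lra.
  have := bound; move/Rabs_def2 => [b1 b2].
  have n1 : (c j0 < c' j0 + w'.+1)%N by apply/ltP; apply: INR_lt; rewrite plus_INR; lra.
  have n2 : (c' j0 < c j0 + w'.+1)%N by apply/ltP; apply: INR_lt; rewrite plus_INR; lra.
  have q1 := divn_eq (c j0) w'.+1; have q2 := divn_eq (c' j0) w'.+1.
  apply: val_inj => /=; rewrite emod in q1.
  have : (c j0 %/ w'.+1 = c' j0 %/ w'.+1)%N by nia.
  by move=> eq_div; rewrite q1 eq_div; exact: esym q2.
have n0 : (0 < n)%N by apply: leq_ltn_trans (ltn_ord j0).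
have p : 0 < / INR m ^ n by apply/Rinv_0_lt_compat/pow_lt.
apply: Rle_trans (Rmult_le_compat_r _ _ _ (Rlt_le _ _ p) (INR_le_ssr cardP)) _.
rewrite INR_muln INR_expn !INR_muln (_ : INR 2 = 2) // Rpow_mult_distr.
have -> : INR m ^ n = INR m * INR m ^ n.-1 by rewrite -{1}(prednK n0).
have mp := pow_lt _ n.-1 m1.
have -> : INR w'.+1 * ((2 * INR L) ^ n.-1 * INR m ^ n.-1) * / (INR m * INR m ^ n.-1) =
   (2 * INR L) ^ n.-1 * (INR w'.+1 * / INR m) by field; lra.
rewrite Rmult_assoc -Rmult_plus_distr_l; apply: Rmult_le_compat_l => //.
rewrite S_INR; apply: (Rmult_le_reg_r (INR m)) => //.
have -> : (INR w' + 1) * / INR m * INR m = INR w' + 1 by field; lra.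
have -> : (8 / Rabs (A j0) * d + / INR m) * INR m = 8 * d * INR m / Rabs (A j0) + 1 by field; lra.
lra.
Qed.

(* Both functions vanish outside the box, so the shift by [k] grid steps may be
   carried out cyclically modulo the number [2 * L * m] of cells in a row. *)
Lemma corner_sum_shift n L m (k : 'I_n -> Z) (g h : pt n -> R) : (0 < m)%N ->
  (forall y, (exists j, INR L <= Rabs (y j)) -> g y = 0) ->
  (forall y, (exists j, INR L <= Rabs (y j)) -> h y = 0) ->
  (forall y, h y = g (fun j => y j - IZR (k j) / INR m)) ->
  corner_sum L m h = corner_sum L m g.
Proof.
move=> m0 g0 h0 e; have m1 := INR_gt0 m0.
pose N := Z.of_nat (2 * L * m).
pose s (c : {ffun 'I_n -> 'I_(2 * L * m)}) j := (Z.of_nat (c j) - k j)%stdZ.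
have N0 (c : {ffun 'I_n -> 'I_(2 * L * m)}) (j : 'I_n) : (0 < N)%stdZ.
  by rewrite /N; have := ltn_ord (c j); lia.
have pf c j : (Z.to_nat (s c j mod N) < 2 * L * m)%N.
  by have := Z.mod_pos_bound (s c j) N (N0 c j); rewrite /N; lia.
pose f c : {ffun 'I_n -> 'I_(2 * L * m)} := [ffun j => Ordinal (pf c j)].
have f_inj : injective f.
  move=> c c' /ffunP ec; apply/ffunP => j; apply: val_inj => /=.
  have := congr1 val (ec j); rewrite !ffunE /= => ej.
  have b1 := Z.mod_pos_bound (s c j) N (N0 c j).
  have b2 := Z.mod_pos_bound (s c' j) N (N0 c j).
  have ez : (s c j mod N = s c' j mod N)%stdZ by lia.
  have d1 := Z.div_mod (s c j) N ltac:(have := N0 c j; lia).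
  have d2 := Z.div_mod (s c' j) N ltac:(have := N0 c j; lia).
  have h1 : (0 <= Z.of_nat (c j) < N)%stdZ by have := ltn_ord (c j); rewrite /N; lia.
  have h2 : (0 <= Z.of_nat (c' j) < N)%stdZ by have := ltn_ord (c' j); rewrite /N; lia.
  rewrite ez in d1; rewrite /s in d1 d2; move: d1 d2.
  set q1 := Z.div _ _; set q2 := Z.div _ _; set r := Z.modulo _ _ => d1 d2.
  have qq : q1 = q2.
    by clear -d1 d2 h1 h2; clearbody q1 q2 r N; nia.
  by apply: Nat2Z.inj; rewrite qq in d1; lia.
rewrite /corner_sum /riemann_sum [RHS](reindex_inj f_inj) /=.
apply: eq_bigr => c _; congr (_ / _).
have LmE : INR (L * m) = INR L * INR m by rewrite INR_muln.
(* The quotient by [N] counts how often coordinate [j] wraps around the box, each wrap being a jump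
   of [2L]. *)
have fE j : corner (f c) j = corner c j - IZR (k j) / INR m - 2 * INR L * IZR (s c j / N).
  have d1 := Z.div_mod (s c j) N ltac:(have := N0 c j; lia).
  have b1 := Z.mod_pos_bound (s c j) N (N0 c j).
  have NE : IZR N = 2 * INR L * INR m by rewrite /N -INR_IZR_INZ !INR_muln (_ : INR 2 = 2).
  have : IZR (s c j mod N) = IZR (s c j) - IZR N * IZR (s c j / N).
    by have := congr1 IZR d1; rewrite plus_IZR mult_IZR; lra.
  rewrite /corner ffunE /= [INR (Z.to_nat _)]INR_IZR_INZ Z2Nat.id; last lia.
  move=> ->; rewrite NE /s minus_IZR -INR_IZR_INZ LmE.
  by field; lra.
have box (c' : {ffun 'I_n -> 'I_(2 * L * m)}) j : - INR L <= corner c' j < INR L.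
  have c0 := pos_INR (c' j).
  have : INR (c' j) < 2 * INR L * INR m.
    have := lt_INR _ _ (ltP (ltn_ord (c' j))).
    by rewrite !INR_muln (_ : INR 2 = 2).
  rewrite /corner LmE => c1; split.
  - by apply: (Rmult_le_reg_r (INR m)) => //; field_simplify; lra.
  - by apply: (Rmult_lt_reg_r (INR m)) => //; field_simplify; lra.
have L0 := pos_INR L.
have out t q : - INR L <= t < INR L -> q <> 0%stdZ -> INR L <= Rabs (t + 2 * INR L * IZR q).
  move=> ht /Z.lt_gt_cases [q0|q0].
  - have : IZR q <= -1 by apply: IZR_le; lia.
    by move=> hq; rewrite -Rabs_Ropp; apply: Rle_trans (Rle_abs _); nra.
  - have : 1 <= IZR q by apply: IZR_le; lia.
    by move=> hq; apply: Rle_trans (Rle_abs _); nra.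
case: (boolP [forall j, Z.eqb (s c j / N)%stdZ 0%stdZ]) => [/forallP q0|].
  rewrite e; congr g; apply: functional_extensionality => j.
  by rewrite fE (proj1 (Z.eqb_eq _ _) (q0 j)); ring.
rewrite negb_forall => /existsP[j /negP qj']; have qj : (s c j / N)%stdZ <> 0%stdZ by move/Z.eqb_eq.
have -> : h (corner c) = 0.
  rewrite e; apply: g0; exists j.
  have -> : corner c j - IZR (k j) / INR m =
      corner (f c) j + 2 * INR L * IZR (s c j / N) by rewrite fE; ring.
  exact: out.
(* After a wrap, the unshifted preimage of this corner lies outside the box, where [h] vanishes; so
   both terms are 0. *)
have -> : g (corner (f c)) = h (fun j => corner (f c) j + IZR (k j) / INR m).
  by rewrite e; congr g; apply: functional_extensionality => i; ring.
symmetry; apply: h0; exists j.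
have -> : corner (f c) j + IZR (k j) / INR m = corner c j + 2 * INR L * IZR (- (s c j / N)).
  by rewrite fE opp_IZR; ring.
by apply: out => //; lia.
Qed.

(** The vector [v] is rounded down to a multiple of [1/m], which changes each value of [g] by at
    most [K/m]; the margin [eta] keeps the rounded translate zero at the boundary of the box. *)
Lemma integ_shift n L (v : pt n) (eta : R) (g : pt n -> R) : lip g -> 0 < eta ->
  (forall y, (exists j, INR L - eta <= Rabs (y j)) -> g y = 0) ->
  (forall y, (exists j, INR L - eta <= Rabs (y j)) -> g (fun j => y j - v j) = 0) ->
  integ L (fun y => g (fun j => y j - v j)) = integ L g.
Proof.
move=> lg eta0 g0 h0; set h := fun y => _.
have lh : lip h.
  apply: lip_pre => // j; apply: lip_plus; [exact: lip_coord | exact: lip_const].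
have [K K0 hK] := lg; have V0 := volume_ge0 n L.
have [m0 m00 hm0] := inv_INR_small Rle_0_1 eta0.
have cv := is_lim_seq_abs _ _ (is_lim_seq_minus' _ _ _ _ (lip_cv L lh) (lip_cv L lg)).
have C0 : 0 <= (2 * INR L) ^ n * K by nra.
suff : Rabs (integ L h - integ L g) <= 0.
  by have := Rabs_pos (integ L h - integ L g) => ? ?; apply: Rminus_diag_uniq; apply: Rabs_eq_0; lra.
refine (lim_seq_loc_le (m0 := m0) _ cv (lim_inv_INR C0)) => m hm m_gt0.
have m1 := INR_gt0 m_gt0; have im := Rinv_0_lt_compat _ m1.
have small := hm0 m hm; rewrite Rmult_1_l in small.
pose k j := (up (v j * INR m) - 1)%stdZ.
have hk j : IZR (k j) / INR m <= v j <= IZR (k j) / INR m + / INR m.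
  have [a1 a2] := archimed (v j * INR m); rewrite /k minus_IZR.
  have e : v j = v j * INR m * / INR m by field; lra.
  have e' : (IZR (up (v j * INR m)) - 1) / INR m + / INR m =
    IZR (up (v j * INR m)) * / INR m by field; lra.
  by rewrite e' [X in _ <= X <= _]e; split; apply: Rmult_le_compat_r; lra.
pose hm' y := g (fun j => y j - IZR (k j) / INR m).
rewrite -(@corner_sum_shift n L m k g hm') //.
- rewrite Rmult_assoc; apply: riemann_sum_diff => // c.
  apply: hK => //; first lra.
  by move=> j; have := hk j => ?; apply: Rabs_le; lra.
- move=> y [j hj]; apply: g0; exists j; lra.
- move=> y [j hj].
  have -> : hm' y = g (fun j => (y j + (v j - IZR (k j) / INR m)) - v j).
    by rewrite /hm'; congr g; apply: functional_extensionality => i; ring.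
  apply: (h0 (fun j => y j + (v j - IZR (k j) / INR m))); exists j.
  have := Rabs_triang_inv (y j) (- (v j - IZR (k j) / INR m)).
  rewrite Rabs_Ropp (Rabs_pos_eq (v j - _)); last by have := hk j; lra.
  by rewrite /Rminus Ropp_involutive; have := hk j; lra.
Qed.

(** * Barycentric coordinates and tent functions *)

(** Barycentric coordinates by their properties instead of by a formula: affine, summing to 1,
    reproducing the point, and unique. The small simplices satisfy the same specification, so every
    lemma on bumps applies to them as well. *)
Definition coordinates (n k : nat) (x : 'I_k -> pt n) (l : 'I_k -> pt n -> R) : Prop :=
  [/\ forall i, exists a A, forall y, l i y = a + \big[Rplus/0]_(j < n) (A j * y j),
      forall y, \big[Rplus/0]_(i < k) l i y = 1,
      forall y j, y j = \big[Rplus/0]_(i < k) (l i y * x i j)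
    & forall c, \big[Rplus/0]_(i < k) c i = 1 ->
        forall i, l i (fun j => \big[Rplus/0]_(h < k) (c h * x h j)) = c i].

(** Prepending a coordinate 1 turns affine independence into invertibility of the square matrix with
    rows [(1, x i)]; the coordinates of [y] are the entries of [(1, y)] times its inverse. *)
Lemma coordinates_exist (n : nat) (x : 'I_n.+1 -> pt n) :
  affinely_independent x -> exists l, coordinates x l.
Proof.
move=> hx.
pose ext (y : pt n) : 'rV[R]_n.+1 := (\row_j (if unlift ord0 j is Some j' then y j' else 1))%R.
pose M : 'M[R]_n.+1 := (\matrix_(i, j) ext (x i) ord0 j)%R.
have ME0 i : M i ord0 = 1 by rewrite !mxE unlift_none.
have MES i j : M i (lift ord0 j) = x i j by rewrite !mxE liftK.
have MU : M \in unitmx.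
  rewrite -row_free_unit -kermx_eq0; apply/rowV0P => v /sub_kermxP hv.
  apply/rowP => i; rewrite mxE; apply: (hx (fun i => v ord0 i)) => [|j].
  - have := congr1 (fun w : 'rV_n.+1 => w ord0 ord0) hv; rewrite !mxE => e.
    rewrite -[RHS]e; apply: eq_bigr => k _; rewrite !mxE unlift_none; exact: esym (Rmult_1_r _).
  - have := congr1 (fun w : 'rV_n.+1 => w ord0 (lift ord0 j)) hv; rewrite !mxE => e.
    by rewrite -[RHS]e; apply: eq_bigr => k _; rewrite !mxE liftK.
exists (fun i y => (ext y *m invmx M)%R ord0 i); split.
- move=> i; exists (invmx M ord0 i), (fun j => invmx M (lift ord0 j) i) => y.
  rewrite mxE big_ord_recl !mxE unlift_none; congr Rplus; first exact: Rmult_1_l.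
  by apply: eq_bigr => j _; rewrite !mxE liftK; exact: Rmult_comm.
- move=> y; have := congr1 (fun w : 'rV_n.+1 => w ord0 ord0) (mulmxKV MU (ext y)).
  rewrite [RHS]mxE unlift_none => e; rewrite -[RHS]e [RHS]mxE.
  by apply: eq_bigr => i _; rewrite ME0; exact: esym (Rmult_1_r _).
- move=> y j; have := congr1 (fun w : 'rV_n.+1 => w ord0 (lift ord0 j)) (mulmxKV MU (ext y)).
  rewrite [RHS]mxE liftK => e; rewrite -[LHS]e [LHS]mxE.
  by apply: eq_bigr => i _; rewrite MES.
- move=> c hc i.
  have -> : ext (fun j => \big[Rplus/0]_h (c h * x h j)) = ((\row_h c h) *m M)%R.
    apply/rowP => j; rewrite !mxE.
    case: unliftP => [j' ->|->].
      by apply: eq_bigr => h _; rewrite !mxE liftK.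
    rewrite -[LHS]hc; apply: eq_bigr => h _; rewrite !mxE unlift_none; exact: esym (Rmult_1_r _).
  by rewrite mulmxK // mxE.
Qed.

Lemma coordinates_lip n k (x : 'I_k -> pt n) l i : coordinates x l -> lip (l i).
Proof.
case=> /(_ i) [a [A e]] _ _ _.
by apply: lip_ext (lip_affine a A) => y; rewrite e.
Qed.

Lemma coordinates_comb n k (x : 'I_k -> pt n) l i (y p q : pt n) :
  coordinates x l -> l i (fun j => y j - p j + q j) = l i y - l i p + l i q.
Proof.
case=> /(_ i) [a [A e]] _ _ _; rewrite !e.
have -> : \big[Rplus/0]_(j < n) (A j * (y j - p j + q j)) =
  \big[Rplus/0]_(j < n) (A j * y j) - \big[Rplus/0]_(j < n) (A j * p j) + \big[Rplus/0]_(j < n) (A j * q j).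
  by rewrite -bigR_sub -big_split /=; apply: eq_bigr => j _; ring.
ring.
Qed.

Lemma coordinates_vertex n k (x : 'I_k -> pt n) l (i h : 'I_k) :
  coordinates x l -> l i (x h) = if i == h then 1 else 0.
Proof.
case=> _ _ _ U.
have pick (F : 'I_k -> R) : \big[Rplus/0]_t ((if t == h then 1 else 0) * F t) = F h.
  rewrite (bigD1 h) //= eqxx big1 => [|t /negbTE ->]; lra.
rewrite -(U (fun t => if t == h then 1 else 0)); last first.
  by rewrite -[RHS](pick (fun=> 1)); apply: eq_bigr => t _; rewrite Rmult_1_r.
by congr l; apply: functional_extensionality => j; rewrite pick.
Qed.

Lemma coordinates_ge0_le1 n k (x : 'I_k -> pt n) l i y : coordinates x l ->
  (forall i, 0 <= l i y) -> l i y <= 1.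
Proof. by case=> _ S _ _ h; rewrite -(S y); apply: (@bigR_term_le _ (fun i => l i y)). Qed.

Lemma in_convE n k (x : 'I_k -> pt n) l y : coordinates x l ->
  in_conv x y <-> forall i, 0 <= l i y.
Proof.
case=> _ S B U; split=> [[c [c0 [c1 e]]] i|h].
- have -> : y = fun j => \big[Rplus/0]_h (c h * x h j) by apply: functional_extensionality.
  by rewrite U.
- by exists (fun i => l i y); split=> //; split.
Qed.

(** The affine map that sends [x i] to [x (s i)]. *)
Definition vertex_map n k (x : 'I_k -> pt n) l (s : {perm 'I_k}) (y : pt n) : pt n :=
  fun j => \big[Rplus/0]_(i < k) (l i y * x (s i) j).

Lemma vertex_map_coord n k (x : 'I_k -> pt n) l s i y : coordinates x l ->
  l i (vertex_map x l s y) = l (s^-1%g i) y.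
Proof.
case=> _ S _ U.
have -> : vertex_map x l s y = fun j => \big[Rplus/0]_h (l (s^-1%g h) y * x h j).
  apply: functional_extensionality => j; rewrite /vertex_map.
  by rewrite [RHS](reindex_inj (@perm_inj _ s)) /=; apply: eq_bigr => h _; rewrite permK.
by apply: (U (fun h => l (s^-1%g h) y)); rewrite -[RHS](S y) [RHS](reindex_inj (@perm_inj _ s^-1%g)).
Qed.

Lemma vertex_mapK n k (x : 'I_k -> pt n) l (s : {perm 'I_k}) y : coordinates x l ->
  vertex_map x l s (vertex_map x l s^-1%g y) = y.
Proof.
move=> X; case: (X) => _ _ B _; apply: functional_extensionality => j.
rewrite [RHS]B /vertex_map (reindex_inj (@perm_inj _ s^-1%g)) /=.
by apply: eq_bigr => i _; rewrite (vertex_map_coord _ _ _ X) invgK permKV.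
Qed.

Lemma lip_vertex_map n k (x : 'I_k -> pt n) l s j : coordinates x l ->
  lip (fun y => vertex_map x l s y j).
Proof.
move=> X; apply: lip_sum => i; apply: lip_ext (lip_scal (x (s i) j) (coordinates_lip i X)) => y.
exact: Rmult_comm.
Qed.

(** The triangle function [max(0, 1 - |t|)], written as a difference so that the sum of its integer
    translates telescopes. *)
Definition hat (t : R) : R := clamp (t + 1) - clamp t.

Lemma hat_01 t : 0 <= hat t <= 1.
Proof. rewrite /hat; unfold_minmax; lra. Qed.

Lemma hat_supp t : hat t <> 0 -> Rabs t < 1.
Proof. rewrite /hat; unfold_minmax; lra. Qed.

Lemma hat_lip s t : Rabs (hat s - hat t) <= 2 * Rabs (s - t).
Proof.
have := clamp_lip (s + 1) (t + 1); have := clamp_lip s t.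
have -> : s + 1 - (t + 1) = s - t by ring.
have -> : hat s - hat t = (clamp (s + 1) - clamp (t + 1)) + - (clamp s - clamp t).
  by rewrite /hat; ring.
move=> ? ?; apply: Rle_trans (Rabs_triang _ _) _; rewrite Rabs_Ropp; lra.
Qed.

Lemma hat_sum (N : nat) (t : R) :
  \big[Rplus/0]_(a < N) hat (t - INR a) = clamp (t + 1) - clamp (t + 1 - INR N).
Proof.
elim: N => [|N IH]; first by rewrite big_ord0 /= Rminus_0_r; ring.
rewrite big_ord_recr IH /= /hat -/(INR N.+1) S_INR.
have -> : t - INR N + 1 = t + 1 - INR N by ring.
have -> : t + 1 - (INR N + 1) = t - INR N by ring.
ring.
Qed.

Definition tent (n : nat) (m : R) (z y : pt n) : R :=
  \big[Rmult/1]_(j < n) hat (m * (y j - z j)).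

Lemma tent_01 n m (z y : pt n) : 0 <= tent m z y <= 1.
Proof. by apply: bigRprod_01 => j; apply: hat_01. Qed.

Lemma tent_supp n m (z y : pt n) : 0 < m -> tent m z y <> 0 ->
  cube_close (/ m) y z.
Proof.
move=> m0 h j; have := hat_supp (bigRprod_neq0 (i := j) h).
rewrite Rabs_mult (Rabs_pos_eq m); last lra.
move=> lt; apply: (Rmult_le_reg_l m) => //; rewrite Rinv_r; lra.
Qed.

Lemma lip_tent n m (z : pt n) : lip (tent m z).
Proof.
apply: lip_prod_01 => [j y|j]; first exact: hat_01.
apply: (@lip_comp n hat 2); [lra | exact: hat_lip |].
apply: lip_scal; apply: lip_plus; [exact: lip_coord | exact: lip_const].
Qed.

(** The sum over grid points of a product over axes factors into a product of one-dimensional sums,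
    and each of these telescopes. *)
Lemma tent_sum n L m (y : pt n) : (0 < m)%N ->
  let S := \big[Rplus/0]_(c : {ffun 'I_n -> 'I_(2 * L * m)}) tent (INR m) (corner c) y in
  0 <= S <= 1 /\ ((forall j, Rabs (y j) <= INR L - / INR m) -> S = 1).
Proof.
move=> m0 S; have m1 := INR_gt0 m0; have im := Rinv_0_lt_compat _ m1.
have SE : S = \big[Rmult/1]_(j < n)
   (clamp (INR m * (y j + INR L) + 1) -
    clamp (INR m * (y j + INR L) + 1 - INR (2 * L * m))).
  rewrite -(eq_bigr _ (fun j _ => hat_sum _ _)) bigA_distr_bigA.
  apply: eq_bigr => c _; apply: eq_bigr => j _; congr hat.
  by rewrite /corner INR_muln; set a := INR (c j); field; lra.
rewrite SE; split.
- apply: bigRprod_01 => j; have := pos_INR (2 * L * m).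
  set a := INR _ * _ + 1; set b := INR (_ * _)%N => b0.
  have := clamp_01 a; have := clamp_01 (a - b).
  by have := @clamp_le (a - b) a; lra.
- move=> h; apply: big1 => j _.
  have := Rle_abs (y j); have := Rle_abs (- y j); rewrite Rabs_Ropp; have := h j.
  move=> h1 h2 h3; rewrite !INR_muln (_ : INR 2 = 2) //.
  have e : INR m * / INR m = 1 by field; lra.
  rewrite clamp_eq1 ?clamp_eq0; [ring| nra | nra].
Qed.

(** Where [g] is nonzero the tents sum to 1, so the error is a weighted mean of differences between
    [g y] and values at corners within [1/m] of [y]. *)
Lemma tent_approx n L m (g : pt n -> R) (K : R) y : (0 < m)%N -> 0 <= K ->
  lip_on (fun _ => True) K g ->
  (g y <> 0 -> forall j, Rabs (y j) <= INR L - / INR m) ->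
  Rabs (g y - \big[Rplus/0]_(c : {ffun 'I_n -> 'I_(2 * L * m)})
     (g (corner c) * tent (INR m) (corner c) y)) <= K * / INR m.
Proof.
move=> m0 K0 hK supp; have m1 := INR_gt0 m0; have im := Rinv_0_lt_compat _ m1.
have /= := tent_sum L y m0; set S := \big[_/_]_c _ => -[S01 S1].
have gS : g y = g y * S.
  by case: (Req_dec (g y) 0) => [->|/supp/S1 ->]; ring.
rewrite gS /S big_distrr /= -bigR_sub.
apply: Rle_trans (bigR_abs _ _ _) _.
apply: Rle_trans (_ : \big[Rplus/0]_c (K * / INR m * tent (INR m) (corner c) y) <= _); last first.
  rewrite -big_distrr /= -[X in _ <= X]Rmult_1_r; apply: Rmult_le_compat_l; last exact: S01.2.
  by apply: Rmult_le_pos; lra.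
apply: bigR_le => c _; rewrite -Rmult_minus_distr_r Rabs_mult.
have t0 := tent_01 (INR m) (corner c) y.
rewrite (Rabs_pos_eq (tent _ _ _)); last lra.
case: (Req_dec (tent (INR m) (corner c) y) 0) => [->|/tent_supp cl]; first lra.
apply: Rmult_le_compat_r; first lra.
by apply: hK => //; [lra | exact: cl].
Qed.

(** A common bound on the reciprocals of the gaps gives a common positive lower bound on the
    gaps. *)
Lemma uniform_margin (I : finType) (F : I -> R) (b : R) : (forall i, F i < b) ->
  exists2 eta, 0 < eta & forall i, F i <= b - eta.
Proof.
move=> h.
have [i u v uv hu|i|K K0 hK] := @common_bound I (fun i K => / (b - F i) <= K).
- lra.
- by exists (/ (b - F i)); [left; apply: Rinv_0_lt_compat; have := h i; lra | lra].
exists (/ (K + 1)) => [|i]; first by apply: Rinv_0_lt_compat; lra.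
have p : 0 < b - F i by have := h i; lra.
suff : / (K + 1) <= b - F i by lra.
rewrite -(Rinv_inv (b - F i)); apply: Rinv_le_contravar.
- exact: Rinv_0_lt_compat.
- have := hK i; lra.
Qed.

Lemma simplex_margin n k (x : 'I_k -> pt n) l L : coordinates x l ->
  (forall i j, Rabs (x i j) < INR L) ->
  exists2 eta, 0 < eta &
    forall y, (forall i, 0 <= l i y) -> forall j, Rabs (y j) <= INR L - eta.
Proof.
move=> [_ S B _] h.
have [eta eta0 he] := @uniform_margin ('I_k * 'I_n)%type (fun p => Rabs (x p.1 p.2))
  (INR L) (fun p => h p.1 p.2).
exists eta => // y y0 j; rewrite B.
apply: Rle_trans (bigR_abs _ _ _) _.
rewrite -[X in _ <= X]Rmult_1_l -(S y) big_distrl /=.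
apply: bigR_le => i _; rewrite Rabs_mult (Rabs_pos_eq _ (y0 i)).
by apply: Rmult_le_compat_l => //; apply: (he (i, j)).
Qed.

(** * Invariance under permutations of the vertices *)

Lemma vertex_map_comb n k (x : 'I_k -> pt n) l s (y p q : pt n) : coordinates x l ->
  vertex_map x l s (fun j => y j - p j + q j) =
  fun j => vertex_map x l s y j - vertex_map x l s p j + vertex_map x l s q j.
Proof.
move=> X; apply: functional_extensionality => j.
rewrite /vertex_map -bigR_sub -big_split /=; apply: eq_bigr => i _.
by rewrite (coordinates_comb _ _ _ _ X); ring.
Qed.

(** With [T] the vertex map, the two integrands are translates of each other by [T^-1 z' - T^-1 z],
    because [T] is affine. *)
Lemma integ_tent_vertex_map n k L (x : 'I_k -> pt n) l s : coordinates x l ->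
  (forall i j, Rabs (x i j) < INR L) ->
  exists m0 : nat, forall m, (m0 <= m)%N -> (0 < m)%N -> forall z z' : pt n,
    (forall i, 0 <= l i z) -> (forall i, 0 <= l i z') ->
    integ L (fun y => tent (INR m) z (vertex_map x l s y)) =
    integ L (fun y => tent (INR m) z' (vertex_map x l s y)).
Proof.
move=> X box.
have [eta eta0 margin] := simplex_margin X box.
pose T := vertex_map x l s; pose Ti := vertex_map x l s^-1%g.
have TiK y : Ti (T y) = y by rewrite /Ti /T -[X in vertex_map x l X y](invgK s) vertex_mapK.
have [M M0 hM] : exists2 M, 0 <= M & forall j, lip_on (fun _ => True) M (fun y => Ti y j).
  apply: (common_bound (P := fun j M => lip_on (fun _ => True) M (fun y => Ti y j))).
    move=> j a b ab h r y z r0 _ _ c.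
    by apply: Rle_trans (h r y z r0 I I c) _; apply: Rmult_le_compat_r.
  by move=> j; apply: (lip_vertex_map _ _ X).
(* Half of the margin absorbs the support of the transformed tent, which extends at most [M/m] from
   a point of the simplex; the other half is left for [integ_shift]. *)
have eta2 : 0 < eta / 2 by lra.
have [m0 m00 hm0] := inv_INR_small M0 eta2.
exists m0 => m hm m_gt0 z z' hz hz'.
have m1 := INR_gt0 m_gt0; have im := Rinv_0_lt_compat _ m1.
have small := hm0 m hm.
have supp p y : (forall i, 0 <= l i p) ->
    (exists j, INR L - eta / 2 <= Rabs (y j)) -> tent (INR m) p (T y) = 0.
  move=> hp [j hj]; case: (Req_dec (tent (INR m) p (T y)) 0) => // /(tent_supp m1) cl.
  have := hM j _ _ _ (Rlt_le _ _ im) I I cl; rewrite TiK.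
  have : Rabs (Ti p j) <= INR L - eta.
    by apply: margin => i; rewrite (vertex_map_coord _ _ _ X).
  have := Rabs_triang_inv (y j) (Ti p j); lra.
pose v j := Ti z' j - Ti z j.
have e y : tent (INR m) z (T (fun j => y j - v j)) = tent (INR m) z' (T y).
  have -> : (fun j => y j - v j) = fun j => y j - Ti z' j + Ti z j.
    by apply: functional_extensionality => j; rewrite /v; ring.
  rewrite /T vertex_map_comb // /Ti !vertex_mapK //.
  by apply: eq_bigr => j _; congr hat; ring.
rewrite -(@integ_shift n L v (eta / 2) (fun y => tent (INR m) z (T y))) //.
- by apply: integ_ext => y; rewrite -/(T _) -[RHS]e.
- by apply: lip_pre (lip_tent _ _) _ => j; apply: lip_vertex_map.
- by move=> y; apply: supp.
- by move=> y hy; rewrite e; apply: supp.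
Qed.

(* Expanding [g] along the tents on the grid expresses both [integ L g] and
   [integ L (g \o vertex_map x l s)] through grid sums of [g], up to a factor which
   does not depend on [g]; the invariant function [g0] shows that it tends to 1. *)
Lemma integ_vertex_map n L (x : 'I_n.+1 -> pt n) l s (g g0 : pt n -> R) :
  coordinates x l -> (forall i j, Rabs (x i j) < INR L) ->
  lip g -> (forall y, g y <> 0 -> forall i, 0 <= l i y) ->
  lip g0 -> (forall y, g0 y <> 0 -> forall i, 0 <= l i y) ->
  (forall y, g0 (vertex_map x l s y) = g0 y) -> 0 < integ L g0 ->
  integ L (fun y => g (vertex_map x l s y)) = integ L g.
Proof.
move=> X box lg sg lg0 sg0 inv pos.
have [eta eta0 margin] := simplex_margin X box.
have [m0 hm0] := integ_tent_vertex_map s X box.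
have [m1 m10 hm1] := inv_INR_small Rle_0_1 eta0.
have V0 := volume_ge0 n L.
have x0 : forall i, 0 <= l i (x ord0).
  by move=> i; rewrite (coordinates_vertex _ _ X); case: eqP; lra.
(* The common integral of the transformed tents, times [m ^ n] to undo the cell weight. The center
   [x ord0] is an arbitrary choice in the simplex. *)
pose b m := integ L (fun y => tent (INR m) (x ord0) (vertex_map x l s y)) * INR m ^ n.
have lipT (h : pt n -> R) : lip h -> lip (fun y => h (vertex_map x l s y)).
  by move=> lh; apply: lip_pre lh _ => j; apply: lip_vertex_map.
have key (h : pt n -> R) K m : 0 <= K -> lip_on (fun _ => True) K h ->
    (forall y, h y <> 0 -> forall i, 0 <= l i y) -> (maxn m0 m1 <= m)%N ->
    (0 < m)%N ->
    Rabs (integ L (fun y => h (vertex_map x l s y)) - b m * corner_sum L m h) <=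
    (2 * INR L) ^ n * (K * / INR m).
  move=> K0 hK sh hm m_gt0.
  have mR := INR_gt0 m_gt0.
  have lh : lip h by exists K.
  have -> : b m * corner_sum L m h = integ L (fun y =>
     \big[Rplus/0]_(c : {ffun 'I_n -> 'I_(2 * L * m)})
       (h (corner c) * tent (INR m) (corner c) (vertex_map x l s y))).
    rewrite integ_sum => [|c]; last first.
      by apply: lip_scal; apply: (lipT (tent _ _)); apply: lip_tent.
    rewrite /corner_sum /riemann_sum big_distrr /=; apply: eq_bigr => c _.
    rewrite integ_scal; last by apply: (lipT (tent _ _)); apply: lip_tent.
    case: (Req_dec (h (corner c)) 0) => [->|/sh hc]; first by rewrite /Rdiv; ring.
    rewrite (hm0 m _ m_gt0 (corner c) (x ord0)) //; last by lia.
    by rewrite /b; field; apply: pow_nonzero; lra.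
  apply: integ_dist.
  - exact: lipT.
  - by apply: lip_sum => c; apply: lip_scal; apply: (lipT (tent _ _)); apply: lip_tent.
  - move=> y; apply: tent_approx => // hy j.
    have := hm1 m ltac:(lia); rewrite Rmult_1_l => ?.
    have := margin _ (sh _ hy) j; lra.
have [K K0 hK] := lg; have [K' K'0 hK'] := lg0.
set J1 := integ L (fun y => g (vertex_map x l s y)).
set J := integ L g; set J0 := integ L g0 in pos *.
have e0 : integ L (fun y => g0 (vertex_map x l s y)) = J0 by apply: integ_ext.
have cv1 := is_lim_seq_minus' _ _ _ _
   (is_lim_seq_scal_l _ J1 _ (lip_cv L lg0)) (is_lim_seq_scal_l _ J0 _ (lip_cv L lg)).
have C0 : 0 <= (2 * INR L) ^ n * K by nra.
have C0' : 0 <= (2 * INR L) ^ n * K' by nra.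
have cv2 := is_lim_seq_plus' _ _ _ _
   (is_lim_seq_mult' _ _ _ _ (lim_inv_INR C0) (is_lim_seq_abs _ _ (lip_cv L lg0)))
   (is_lim_seq_mult' _ _ _ _ (lim_inv_INR C0') (is_lim_seq_abs _ _ (lip_cv L lg))).
have := lim_seq_loc_le (m0 := maxn m0 m1) _ (is_lim_seq_abs _ _ cv1) cv2.
have h : forall m, (maxn m0 m1 <= m)%N -> (0 < m)%N ->
  Rabs (J1 * corner_sum L m g0 - J0 * corner_sum L m g) <=
  (2 * INR L) ^ n * K * / INR m * Rabs (corner_sum L m g0) +
  (2 * INR L) ^ n * K' * / INR m * Rabs (corner_sum L m g).
  move=> m hm m_gt0.
  have h1 := key g K m K0 hK sg hm m_gt0.
  have h2 := key g0 K' m K'0 hK' sg0 hm m_gt0; rewrite e0 -/J1 in h1 h2.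
  have -> : J1 * corner_sum L m g0 - J0 * corner_sum L m g =
    (J1 - b m * corner_sum L m g) * corner_sum L m g0 +
    - ((J0 - b m * corner_sum L m g0) * corner_sum L m g) by ring.
  apply: Rle_trans (Rabs_triang _ _) _; rewrite Rabs_Ropp !Rabs_mult.
  apply: Rplus_le_compat; (apply: Rmult_le_compat_r; first exact: Rabs_pos);
    rewrite Rmult_assoc; assumption.
move=> /(_ h); rewrite /= !Rmult_0_l Rplus_0_l -/J -/J0 => le.
have := Rabs_pos (J1 * J0 - J0 * J) => ge.
have /Rabs_eq_0 : Rabs (J1 * J0 - J0 * J) = 0 by lra.
move=> e; apply: (Rmult_eq_reg_l J0); lra.
Qed.

(** * Bumps and flags *)

(** A Lipschitz stand-in for the indicator of the simplex: for [d > 0] it vanishes unless all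
    coordinates exceed [d], and is 1 once all are at least [2d]. *)
Definition simplex_bump (n k : nat) (d : R) (l : 'I_k -> pt n -> R) (y : pt n) : R :=
  \big[Rmult/1]_(i < k) clamp (l i y / d - 1).

Lemma bump_01 n k d (l : 'I_k -> pt n -> R) y : 0 <= simplex_bump d l y <= 1.
Proof. by apply: bigRprod_01 => i; apply: clamp_01. Qed.

Lemma lip_bump n k d (x : 'I_k -> pt n) l : coordinates x l -> lip (simplex_bump d l).
Proof.
move=> X; apply: lip_prod_01 => [i y|i]; first exact: clamp_01.
apply: lip_clamp; apply: lip_plus; last exact: lip_const.
by apply: lip_ext (lip_scal (/ d) (coordinates_lip i X)) => y; rewrite /Rdiv Rmult_comm.
Qed.

Lemma bump_supp n k d (l : 'I_k -> pt n -> R) y : 0 < d ->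
  simplex_bump d l y <> 0 -> forall i, d < l i y.
Proof.
move=> d0 h i; apply: Rnot_le_lt => le; apply: (bigRprod_neq0 (i := i) h).
apply: clamp_eq0; have : l i y / d <= 1; last lra.
by apply: (Rmult_le_reg_r d) => //; field_simplify; lra.
Qed.

Lemma bump_supp_ge0 n k d (l : 'I_k -> pt n -> R) y : 0 < d ->
  simplex_bump d l y <> 0 -> forall i, 0 <= l i y.
Proof. by move=> d0 h i; have := bump_supp d0 h i; lra. Qed.

Lemma bump_eq1 n k d (l : 'I_k -> pt n -> R) y : 0 < d ->
  (forall i, 2 * d <= l i y) -> simplex_bump d l y = 1.
Proof.
move=> d0 h; apply: big1 => i _; apply: clamp_eq1.
have : 2 <= l i y / d; last lra.
by apply: (Rmult_le_reg_r d) => //; field_simplify; have := h i; lra.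
Qed.

Lemma bump_vertex_map n k d (x : 'I_k -> pt n) l s y : coordinates x l ->
  simplex_bump d l (vertex_map x l s y) = simplex_bump d l y.
Proof.
move=> X; rewrite /simplex_bump [RHS](reindex_inj (@perm_inj _ s^-1%g)) /=.
by apply: eq_bigr => i _; rewrite (vertex_map_coord _ _ _ X).
Qed.

(** At the barycenter all coordinates equal [1/(n+1)], which is at least [2d], so the bump is 1
    there. This is the origin of the smallness condition on [d]. *)
Lemma integ_bump_gt0 n L d (x : 'I_n.+1 -> pt n) l : coordinates x l ->
  (forall i j, Rabs (x i j) < INR L) -> 0 < d -> 2 * d <= / INR n.+1 ->
  0 < integ L (simplex_bump d l).
Proof.
move=> X box d0 hd; have [_ _ _ U] := X.
have n0 : 0 < INR n.+1 by apply: INR_gt0.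
pose z : pt n := fun j => \big[Rplus/0]_(h < n.+1) (/ INR n.+1 * x h j).
have lz i : l i z = / INR n.+1.
  by apply: (U (fun=> / INR n.+1)); rewrite bigR_const_ord; field; lra.
have iz : 0 < / INR n.+1 by apply: Rinv_0_lt_compat.
apply: (@integ_gt0 n L _ z); first exact: lip_bump X.
- by move=> y; have := bump_01 d l y; lra.
- move=> j; have [eta eta0 margin] := simplex_margin X box.
  have hz i : 0 <= l i z by rewrite lz; lra.
  have := margin z hz j; lra.
- by rewrite bump_eq1 //; [lra | move=> i; rewrite lz].
Qed.

Lemma lip_coord_bump n k d (x : 'I_k -> pt n) l i : coordinates x l -> 0 < d ->
  lip (fun y => l i y * simplex_bump d l y).
Proof.
move=> X d0; have [K K0 hK] := coordinates_lip i X.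
apply: (@lip_mul_supp n (l i) _ K 1 1) => //; first lra.
- by move=> r y z r0 _ _ c; apply: hK.
- move=> y /(bump_supp_ge0 d0) h; rewrite Rabs_pos_eq //.
  exact: (coordinates_ge0_le1 i X h).
- by move=> y; rewrite Rabs_pos_eq; have := bump_01 d l y; lra.
- exact: lip_bump X.
Qed.

(* The transposition of two vertices preserves the bump and exchanges the two
   barycentric coordinates. *)
Lemma integ_coord_bump n L d (x : 'I_n.+1 -> pt n) l i : coordinates x l ->
  (forall i j, Rabs (x i j) < INR L) -> 0 < d -> 2 * d <= / INR n.+1 ->
  integ L (fun y => l i y * simplex_bump d l y) = / INR n.+1 * integ L (simplex_bump d l).
Proof.
move=> X box d0 hd; have [_ S _ _] := X.
have n0 : 0 < INR n.+1 by apply: INR_gt0.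
have swap h : integ L (fun y => l h y * simplex_bump d l y) =
    integ L (fun y => l i y * simplex_bump d l y).
  rewrite -(@integ_vertex_map n L x l (tperm i h) _ (simplex_bump d l) X) //.
  - apply: integ_ext => y.
    by rewrite (vertex_map_coord _ _ _ X) bump_vertex_map // tpermV tpermR.
  - exact: lip_coord_bump X d0.
  - move=> y h0; apply: (bump_supp_ge0 d0) => e; apply: h0; rewrite e; ring.
  - exact: lip_bump X.
  - by move=> y; apply: bump_supp_ge0.
  - by move=> y; apply: bump_vertex_map.
  - exact: integ_bump_gt0 X box d0 hd.
have -> : integ L (simplex_bump d l) =
    \big[Rplus/0]_(h < n.+1) integ L (fun y => l h y * simplex_bump d l y).
  rewrite -integ_sum => [|h]; last exact: lip_coord_bump X d0.
  by apply: integ_ext => y; rewrite -big_distrl /= S; ring.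
rewrite (eq_bigr (fun=> integ L (fun y => l i y * simplex_bump d l y))) => [|h _]; last exact: swap.
by rewrite bigR_const_ord; field; lra.
Qed.

(** The value 0 beyond the range makes the boundary term of Abel summation vanish. *)
Definition ord_ext (k : nat) (F : 'I_k -> R) (a : nat) : R := oapp F 0 (insub a).

Lemma ord_extE k (F : 'I_k -> R) (i : 'I_k) : ord_ext F i = F i.
Proof. by rewrite /ord_ext valK. Qed.

Lemma ord_ext_out k (F : 'I_k -> R) a : (k <= a)%N -> ord_ext F a = 0.
Proof. by move=> h; rewrite /ord_ext insubF // ltnNge h. Qed.

Lemma abel_sum (N : nat) (u X : nat -> R) :
  \big[Rplus/0]_(i < N) ((u i - u i.+1) * \big[Rplus/0]_(h < i.+1) X h) =
  \big[Rplus/0]_(i < N) (u i * X i) - u N * \big[Rplus/0]_(h < N) X h.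
Proof.
elim: N => [|N IH]; first by rewrite !big_ord0; ring.
by rewrite big_ord_recr IH [X in _ = X - _]big_ord_recr big_ord_recr /=; ring.
Qed.

Definition lower (k : nat) (i : 'I_k) : {set 'I_k} := [set h : 'I_k | (h <= i)%N].

Definition flag (n k : nat) (x : 'I_k -> pt n) (s : {perm 'I_k}) (i : 'I_k) : pt n :=
  barycenter x (s @: lower i).

(* By Abel summation, [y = \sum_i (l (s i) y - l (s i.+1) y) \sum_(h <= i) x (s h)],
   where the coordinate of index [k] is 0; the inner sum is [i.+1] times the
   [i]-th vertex of the flag. *)
Definition flag_coord (n k : nat) (l : 'I_k -> pt n -> R) (s : {perm 'I_k})
    (i : 'I_k) (y : pt n) : R :=
  INR i.+1 * (l (s i) y - ord_ext (fun h => l (s h) y) i.+1).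

Lemma lower_sum k (i : 'I_k) (F : 'I_k -> R) :
  \big[Rplus/0]_(h in lower i) F h = \big[Rplus/0]_(h < i.+1) ord_ext F h.
Proof.
rewrite (big_ord_widen_cond k xpredT (ord_ext F)) //=.
by apply: eq_big => h; rewrite ?inE ?ord_extE.
Qed.

Lemma card_flag_face k (s : {perm 'I_k}) (i : 'I_k) : #|s @: lower i| = i.+1.
Proof.
rewrite card_imset; last exact: perm_inj.
rewrite -sum1_card (eq_bigl (fun h : 'I_k => (h < i.+1)%N)) => [|h]; last by rewrite inE.
by rewrite -(big_ord_widen k (fun=> 1%N)) // sum1_card card_ord.
Qed.

Lemma flagE n k (x : 'I_k -> pt n) s i j :
  flag x s i j = / INR i.+1 * \big[Rplus/0]_(h < i.+1) ord_ext (fun h => x (s h) j) h.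
Proof.
rewrite /flag /barycenter card_flag_face -lower_sum big_imset //=.
by move=> a b _ _; apply: perm_inj.
Qed.

Lemma flag_coordinates n k (x : 'I_k -> pt n) l s : coordinates x l ->
  coordinates (flag x s) (flag_coord l s).
Proof.
move=> X; have [Aff S B U] := X.
have i0 i : INR i.+1 <> 0 by have := INR_gt0 (ltn0Sn i); lra.
split.
- move=> i.
  have [a [A e]] : exists a A, forall y, ord_ext (fun h => l (s h) y) i.+1 =
      a + \big[Rplus/0]_(j < n) (A j * y j).
    rewrite /ord_ext; case: (insub i.+1) => [h|] /=; first exact: Aff.
    by exists 0, (fun=> 0) => y; rewrite big1 => [|j _]; ring.
  have [a' [A' e']] := Aff (s i).
  exists (INR i.+1 * (a' - a)), (fun j => INR i.+1 * (A' j - A j)) => y.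
  rewrite /flag_coord e e'.
  rewrite [X in _ = _ + X](eq_bigr (fun j => INR i.+1 * (A' j * y j - A j * y j)))
    => [|j _]; last ring.
  by rewrite -big_distrr /= bigR_sub; ring.
- move=> y; pose u := ord_ext (fun h => l (s h) y).
  have := abel_sum k u (fun=> 1); have uk : u k = 0 by apply: ord_ext_out.
  rewrite uk Rmult_0_l Rminus_0_r.
  rewrite [X in _ = X -> _](eq_bigr (fun i : 'I_k => l (s i) y)) => [|i _]; last first.
    by rewrite Rmult_1_r; apply: ord_extE.
  have -> : \big[Rplus/0]_(i < k) l (s i) y = 1.
    by rewrite -[RHS](S y) [RHS](reindex_inj (@perm_inj _ s)).
  move=> e; rewrite -[RHS]e.
  apply: eq_bigr => i _; rewrite bigR_const_ord /flag_coord /u ord_extE; ring.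
- move=> y j; pose u := ord_ext (fun h => l (s h) y).
  have := abel_sum k u (ord_ext (fun h => x (s h) j)).
  have uk : u k = 0 by apply: ord_ext_out.
  rewrite uk Rmult_0_l Rminus_0_r.
  rewrite [X in _ = X -> _](eq_bigr (fun i : 'I_k => l (s i) y * x (s i) j)) => [|i _]; last first.
    by rewrite /u !ord_extE.
  have -> : \big[Rplus/0]_(i < k) (l (s i) y * x (s i) j) = y j.
    by rewrite [RHS]B [RHS](reindex_inj (@perm_inj _ s)).
  move=> e; rewrite -[LHS]e.
  apply: eq_bigr => i _; rewrite flagE /flag_coord /u ord_extE.
  by set w := \big[_/_]_(_ < _) _; field.
- move=> c hc i.
  (* The weight of [x t] in the combination: each flag vertex [a] whose face contains [t] spreads
     [c a] evenly over [a.+1] vertices. *)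
  pose D t := \big[Rplus/0]_(a < k | t \in s @: lower a) (c a * / INR a.+1).
  have D1 : \big[Rplus/0]_(t < k) D t = 1.
    rewrite -hc /D (exchange_big_dep xpredT) //=; apply: eq_bigr => a _.
    by rewrite (bigR_const (s @: lower a)) card_flag_face -/(INR a.+1); field.
  set y := fun j => _.
  have yE : y = fun j => \big[Rplus/0]_(t < k) (D t * x t j).
    apply: functional_extensionality => j; rewrite /y /D.
    under [RHS]eq_bigr => t _ do rewrite big_distrl /=.
    rewrite [RHS](exchange_big_dep xpredT) //=; apply: eq_bigr => a _.
    by rewrite -big_distrr /= /flag /barycenter card_flag_face -/(INR a.+1) Rmult_assoc.
  have lE t : l t y = D t by rewrite yE U.
  (* The vertex [s h] lies in exactly the faces of position at least [h], so its weight is a tail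
     sum; consecutive tails differ by the single term that recovers [c i]. *)
  pose E (a : nat) := \big[Rplus/0]_(h < k | (a <= h)%N) (c h * / INR h.+1).
  have DE (h : 'I_k) : D (s h) = E h.
    by apply: eq_bigl => a; rewrite mem_imset ?inE //; apply: perm_inj.
  have -> : flag_coord l s i y = INR i.+1 * (E i - E i.+1).
    rewrite /flag_coord lE DE; congr (_ * (_ - _)).
    rewrite /ord_ext; case: insubP => [h _ <-|h] /=; first by rewrite lE DE.
    rewrite /E big_pred0 // => a; apply/negbTE; rewrite -ltnNge.
    by apply: leq_trans (ltn_ord a) _; rewrite leqNgt.
  have -> : E i = c i * / INR i.+1 + E i.+1.
    rewrite /E (bigD1 i) //=; congr (_ + _); apply: eq_bigl => a.
    by rewrite ltn_neqAle andbC eq_sym.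
  by field.
Qed.

(** * The barycentric subdivision *)

Lemma perm_of_uniq k (t : seq 'I_k) : uniq t -> size t = k ->
  exists s : {perm 'I_k}, forall i x0, s i = nth x0 t i.
Proof.
move=> ut st.
have f_inj : injective (fun i : 'I_k => nth i t i).
  move=> i j /eqP; rewrite (set_nth_default i j) ?st //.
  by rewrite nth_uniq ?st // => /eqP /val_inj.
by exists (perm f_inj) => i x0; rewrite permE; apply: set_nth_default; rewrite st.
Qed.

Lemma sorting_perm k (v : 'I_k -> R) :
  exists s : {perm 'I_k}, forall a b : 'I_k, (a <= b)%N -> v (s b) <= v (s a).
Proof.
pose le (i j : 'I_k) : bool := Rle_dec (v j) (v i).
have leP i j : reflect (v j <= v i) (le i j).
  by rewrite /le; case: Rle_dec => h; constructor.
pose t := sort le (enum 'I_k).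
have [|| s hs] := @perm_of_uniq k t.
- by rewrite sort_uniq enum_uniq.
- by rewrite size_sort size_enum_ord.
exists s => a b ab; rewrite (hs a a) (hs b a); apply/leP.
apply: (@sorted_leq_nth _ le) => //.
- by move=> y x z /leP h1 /leP h2; apply/leP; lra.
- by move=> x; apply/leP; lra.
- apply: sort_sorted => x y; apply/orP.
  by case: (Rle_lt_dec (v y) (v x)) => h; [left|right]; apply/leP; lra.
- by rewrite inE size_sort size_enum_ord.
- by rewrite inE size_sort size_enum_ord.
Qed.

Lemma flag_coord_step n k (l : 'I_k -> pt n -> R) (s : {perm 'I_k}) y (i : 'I_k) :
  let u := ord_ext (fun h => l (s h) y) in
  u i - u i.+1 = flag_coord l s i y * / INR i.+1.
Proof.
move=> u; rewrite /flag_coord /u ord_extE -/u; field.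
by have := INR_gt0 (ltn0Sn i); lra.
Qed.

Lemma flag_coord_mono n k (l : 'I_k -> pt n -> R) (s : {perm 'I_k}) y :
  (forall i, 0 <= flag_coord l s i y) ->
  forall a b : nat, (a <= b)%N ->
  ord_ext (fun h => l (s h) y) b <= ord_ext (fun h => l (s h) y) a.
Proof.
move=> h a b; elim: b => [|b IH]; first by rewrite leqn0 => /eqP ->; lra.
rewrite leq_eqVlt => /orP[/eqP ->|ab]; first lra.
apply: Rle_trans (IH ab); case: (ltnP b k) => bk; last first.
  by rewrite !ord_ext_out //; [lra | lia].
have := flag_coord_step l s y (Ordinal bk); have := h (Ordinal bk) => /=.
have := Rinv_0_lt_compat _ (INR_gt0 (ltn0Sn b)); rewrite -/(INR b.+1) => ? ?.
have : 0 <= flag_coord l s (Ordinal bk) y * / INR b.+1 by apply: Rmult_le_pos; lra.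
lra.
Qed.

(** Flag coordinates are scaled gaps between consecutive sorted coordinates, with scale at most [k].
    A bump on a small simplex thus stays at depth [d/k] inside the large one, even along its
    faces. *)
Lemma flag_coord_ge n k (l : 'I_k -> pt n -> R) (s : {perm 'I_k}) y d : 0 <= d ->
  (forall i, d <= flag_coord l s i y) -> forall t, d / INR k <= l t y.
Proof.
move=> d0 h t; have h0 i : 0 <= flag_coord l s i y by have := h i; lra.
pose a := (s^-1)%g t; have := flag_coord_step l s y a => /=.
rewrite ord_extE /a permKV -/a -/(INR a.+1).
have : 0 <= ord_ext (fun i => l (s i) y) a.+1.
  by rewrite -(ord_ext_out (fun i => l (s i) y) (leqnn k)); apply: flag_coord_mono.
have ka : / INR k <= / INR a.+1.
  by apply: Rinv_le_contravar; [apply: INR_gt0 | apply: INR_le_ssr; apply: ltn_ord].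
have ik : 0 < / INR k by apply/Rinv_0_lt_compat/INR_gt0/(leq_ltn_trans _ (ltn_ord a)).
have : d / INR k <= flag_coord l s a y * / INR a.+1.
  by apply: Rmult_le_compat => //; lra.
lra.
Qed.

Lemma flag_coord_lt n k (l : 'I_k -> pt n -> R) (s : {perm 'I_k}) y :
  (forall i, 0 < flag_coord l s i y) ->
  forall a b : 'I_k, (a < b)%N -> l (s b) y < l (s a) y.
Proof.
move=> h a b ab.
have h0 i : 0 <= flag_coord l s i y by have := h i; lra.
have := flag_coord_step l s y a => /=; have := flag_coord_mono h0 ab.
rewrite !ord_extE -/(INR a.+1).
have := Rmult_lt_0_compat _ _ (h a) (Rinv_0_lt_compat _ (INR_gt0 (ltn0Sn a))).
lra.
Qed.

(* The position of [s a] is the number of coordinates larger than its own. *)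
Lemma flag_rank n k (l : 'I_k -> pt n -> R) (s : {perm 'I_k}) y :
  (forall i, 0 < flag_coord l s i y) ->
  forall a : 'I_k, #|[set t | Rlt_dec (l (s a) y) (l t y)]| = a.
Proof.
move=> h a; have lt := flag_coord_lt h.
have -> : [set t | Rlt_dec (l (s a) y) (l t y)] = s @: [set b : 'I_k | (b < a)%N].
  apply/setP => t; rewrite -[t](permKV s) mem_imset ?inE; last exact: perm_inj.
  set b := (s^-1)%g t; case: Rlt_dec => hb /=.
  - case: ltngtP hb => // [/lt|/val_inj ->]; lra.
  - by case: ltngtP hb => // /lt.
rewrite card_imset; last exact: perm_inj.
rewrite -sum1_card (eq_bigl (fun h : 'I_k => (h < a)%N)) => [|b]; last by rewrite inE.
by rewrite -(big_ord_widen k (fun=> 1%N)) ?sum1_card ?card_ord // ltnW.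
Qed.

(** The small simplices have disjoint interiors: strict positivity makes the coordinates distinct,
    and their ranks recover the ordering. *)
Lemma flag_unique n k (l : 'I_k -> pt n -> R) (s s' : {perm 'I_k}) y :
  (forall i, 0 < flag_coord l s i y) -> (forall i, 0 < flag_coord l s' i y) ->
  s = s'.
Proof.
move=> h h'; apply/permP => a; rewrite -(permKV s' (s a)); congr (s' _).
apply: val_inj; rewrite /= -(flag_rank h a) -(flag_rank h' ((s'^-1)%g (s a))).
by rewrite permKV.
Qed.

Definition flag_bumps (n k : nat) (d : R) (l : 'I_k -> pt n -> R) (y : pt n) : R :=
  \big[Rplus/0]_(s : {perm 'I_k}) simplex_bump d (flag_coord l s) y.

Definition flag_slabs (n k : nat) (d : R) (l : 'I_k -> pt n -> R) (y : pt n) : R :=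
  \big[Rplus/0]_(s : {perm 'I_k}) \big[Rplus/0]_(i < k) slab d (flag_coord l s i y).

Lemma flag_bumps_cases n k d (l : 'I_k -> pt n -> R) y : 0 < d ->
  flag_bumps d l y = 0 \/
  exists s, flag_bumps d l y = simplex_bump d (flag_coord l s) y /\
    forall i, d < flag_coord l s i y.
Proof.
move=> d0; case: (boolP [exists s : {perm 'I_k}, simplex_bump d (flag_coord l s) y != 0]).
- move=> /existsP[s /eqP hs]; right; exists s.
  have p := bump_supp d0 hs; split=> //.
  rewrite /flag_bumps (bigD1 s) //= big1 ?Rplus_0_r // => s' ss'.
  case: (Req_dec (simplex_bump d (flag_coord l s') y) 0) => // /(bump_supp d0) p'.
  case/eqP: ss'; apply: (@flag_unique n k l s' s y) => i.
  + by have := p' i; lra.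
  + by have := p i; lra.
- rewrite negb_exists => /forallP h; left; apply: big1 => s _.
  by have := h s; rewrite negbK => /eqP.
Qed.

Lemma flag_bumps_01 n k d (l : 'I_k -> pt n -> R) y : 0 < d ->
  0 <= flag_bumps d l y <= 1.
Proof.
move=> d0; case: (flag_bumps_cases l y d0) => [->|[s [-> _]]]; first lra.
exact: bump_01.
Qed.

Lemma flag_bumps_supp n k d (l : 'I_k -> pt n -> R) y : 0 < d ->
  flag_bumps d l y <> 0 -> forall t, d / INR k <= l t y.
Proof.
move=> d0; case: (flag_bumps_cases l y d0) => [-> //|[s [_ h]]] _.
by apply: (@flag_coord_ge n k l s) => [|i]; [lra | have := h i; lra].
Qed.

Lemma lip_flag_bumps n k d (x : 'I_k -> pt n) l : coordinates x l ->
  lip (flag_bumps d l).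
Proof. by move=> X; apply: lip_sum => s; apply: lip_bump (flag_coordinates s X). Qed.

Lemma lip_flag_slabs n k d (x : 'I_k -> pt n) l : coordinates x l ->
  lip (flag_slabs d l).
Proof.
move=> X; apply: lip_sum => s; apply: lip_sum => i; apply: lip_slab.
exact: coordinates_lip (flag_coordinates s X).
Qed.

Lemma flag_slabs_ge0 n k d (l : 'I_k -> pt n -> R) y : 0 <= flag_slabs d l y.
Proof.
by apply: bigR_ge0 => s _; apply: bigR_ge0 => i _; apply: (clamp_01 _).1.
Qed.

(** Sorting the coordinates of [y] in decreasing order finds a small simplex containing it. Either
    some flag coordinate is below [2d], and its slab is 1, or the bump of that flag is 1. *)
Lemma flag_bumps_approx n k d (l : 'I_k -> pt n -> R) y : 0 < d ->
  (forall i, 0 <= l i y) -> Rabs (1 - flag_bumps d l y) <= flag_slabs d l y.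
Proof.
move=> d0 l0; have [s hs] := sorting_perm (fun i => l i y).
have f0 i : 0 <= flag_coord l s i y.
  apply: Rmult_le_pos; first exact: pos_INR.
  rewrite /ord_ext; case: insubP => [h _ e|_] /=; last by have := l0 (s i); lra.
  by have := hs i h; rewrite e => /(_ (leqnSn i)); lra.
case: (boolP [exists i, Rlt_dec (flag_coord l s i y) (2 * d)]).
- move=> /existsP[i]; case: Rlt_dec => // lt _.
  have S0 i' s' : 0 <= slab d (flag_coord l s' i' y) by apply: (clamp_01 _).1.
  have S1 : slab d (flag_coord l s i y) = 1.
    apply: clamp_eq1; rewrite Rabs_pos_eq //.
    have : flag_coord l s i y / (2 * d) <= 1; last lra.
    by apply: (Rmult_le_reg_r (2 * d)); [lra | field_simplify; lra].
  have : 1 <= flag_slabs d l y.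
    rewrite -S1; apply: Rle_trans (_ : \big[Rplus/0]_(i < k) slab d (flag_coord l s i y) <= _).
      exact: (@bigR_term_le _ (fun i => slab d (flag_coord l s i y)) i).
    apply: (@bigR_term_le _ (fun s => \big[Rplus/0]_(i < k) slab d (flag_coord l s i y)) s) => s'.
    exact: bigR_ge0.
  by have := flag_bumps_01 l y d0 => *; rewrite Rabs_pos_eq; lra.
- rewrite negb_exists => /forallP h.
  have b1 : simplex_bump d (flag_coord l s) y = 1.
    by apply: bump_eq1 => // i; have := h i; case: Rlt_dec => //= ? _; lra.
  have : 1 <= flag_bumps d l y.
    rewrite -b1; apply: (@bigR_term_le _ (fun s => simplex_bump d (flag_coord l s) y)) => s'.
    exact: (bump_01 _ _ _).1.
  have := flag_bumps_01 l y d0; have := flag_slabs_ge0 d l y => *.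
  by apply: Rabs_le; lra.
Qed.

Lemma integ_coord_slab n L (x : 'I_n.+1 -> pt n) l i : (0 < n)%N ->
  coordinates x l ->
  exists2 C, 0 <= C & forall d, 0 < d -> integ L (fun y => slab d (l i y)) <= C * d.
Proof.
move=> n0 X; have [/(_ i) [a [A e]] _ _ _] := X.
(* A coordinate function takes the values 1 and 0 at two different vertices, which exist since
   [n > 0], so its linear part is nonzero. *)
have [j0 hj] : exists j, A j <> 0.
  case: (classic (exists j, A j <> 0)) => // h.
  have A0 j : A j = 0 by case: (Req_dec (A j) 0) => // hj; case: h; exists j.
  have const y z : l i y = l i z.
    by rewrite !e; congr Rplus; apply: eq_bigr => j _; rewrite A0; ring.
  have [i' hi] : exists i' : 'I_n.+1, i' != i.
    case: (eqVneq i ord0) => [->|hi]; last by exists ord0; rewrite eq_sym.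
    by exists ord_max; rewrite -val_eqE /= -lt0n.
  have := const (x i) (x i'); rewrite !(coordinates_vertex _ _ X) eqxx eq_sym (negbTE hi).
  lra.
exists ((2 * INR L) ^ n.-1 * (8 / Rabs (A j0))) => [|d d0].
  apply: Rmult_le_pos; first exact: volume_ge0.
  by apply: Rmult_le_pos; [lra | left; apply/Rinv_0_lt_compat/Rabs_pos_lt].
rewrite (integ_ext L (h := fun y => slab d (a + \big[Rplus/0]_j (A j * y j)))).
  exact: integ_slab.
by move=> y; rewrite e.
Qed.

Lemma integ_flag_slabs n L (x : 'I_n.+1 -> pt n) l : (0 < n)%N -> coordinates x l ->
  exists2 C, 0 <= C & forall d, 0 < d -> integ L (flag_slabs d l) <= C * d.
Proof.
move=> n0 X.
have [p a b ab h d d0|[s i]|C C0 hC] := @common_bound ({perm 'I_n.+1} * 'I_n.+1)%type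
  (fun p C => forall d, 0 < d -> integ L (fun y => slab d (flag_coord l p.1 p.2 y)) <= C * d).
- by apply: Rle_trans (h d d0) _; apply: Rmult_le_compat_r; lra.
- exact: integ_coord_slab (flag_coordinates s X).
exists (INR #|{perm 'I_n.+1}| * (INR n.+1 * C)) => [|d d0].
  by apply: Rmult_le_pos; [exact: pos_INR | apply: Rmult_le_pos => //; exact: pos_INR].
have lipS s i : lip (fun y => slab d (flag_coord l s i y)).
  by apply: lip_slab; apply: coordinates_lip (flag_coordinates s X).
rewrite /flag_slabs integ_sum => [|s]; last exact: lip_sum.
rewrite Rmult_assoc -bigR_const; apply: bigR_le => s _.
rewrite integ_sum // Rmult_assoc -bigR_const_ord; apply: bigR_le => i _.
exact: (hC (s, i)).
Qed.

(** * Convex functions on a simplex *)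

(** Listing [K] first and its complement afterwards gives the permutation. *)
Lemma perm_onto_set k (K : {set 'I_k}) (i : 'I_k) : #|K| = i.+1 ->
  exists s : {perm 'I_k}, s @: lower i = K.
Proof.
move=> cK.
have ut : uniq (enum K ++ enum (~: K)).
  rewrite cat_uniq !enum_uniq andbT; apply/hasPn => h.
  by rewrite !mem_enum inE.
have st : size (enum K ++ enum (~: K)) = k.
  by rewrite size_cat -!cardE cardsC card_ord.
have [s hs] := perm_of_uniq ut st; exists s.
apply/eqP; rewrite eqEcard card_flag_face cK leqnn andbT.
apply/subsetP => _ /imsetP[h hh ->]; rewrite (hs h h) nth_cat -cardE cK.
rewrite inE in hh; rewrite ltnS hh -mem_enum; apply: mem_nth.
by rewrite -cardE cK ltnS.
Qed.

(* The left-hand sum only depends on the cardinality of the moved set. *)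
Lemma flag_face_sum k (i : 'I_k) (F : {set 'I_k} -> R) :
  INR 'C(k, i.+1) * \big[Rplus/0]_(s : {perm 'I_k}) F (s @: lower i) =
  INR #|{perm 'I_k}| * \big[Rplus/0]_(K : {set 'I_k} | #|K| == i.+1) F K.
Proof.
have -> : 'C(k, i.+1) = #|[set K : {set 'I_k} | #|K| == i.+1]|.
  by rewrite card_draws card_ord.
rewrite -!bigR_const.
transitivity (\big[Rplus/0]_(K : {set 'I_k} | #|K| == i.+1)
    \big[Rplus/0]_(s : {perm 'I_k}) F (s @: K)).
  apply: eq_big => K; rewrite inE // => /eqP /perm_onto_set [t <-].
  rewrite (reindex_inj (mulgI t)); apply: eq_bigr => s _; congr F.
  rewrite -imset_comp; apply: eq_imset => h; exact: permM.
rewrite exchange_big; apply: eq_bigr => s _.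
rewrite [RHS](reindex_inj (imset_inj (@perm_inj _ s))) /=.
by apply: eq_bigl => K; rewrite card_imset //; apply: perm_inj.
Qed.

Lemma in_conv_comb n k (x : 'I_k -> pt n) y z t : 0 <= t <= 1 ->
  in_conv x y -> in_conv x z -> in_conv x (fun j => t * y j + (1 - t) * z j).
Proof.
move=> t01 [a [a0 [a1 ae]]] [b [b0 [b1 be]]].
exists (fun i => t * a i + (1 - t) * b i); split.
  by move=> i; have := a0 i; have := b0 i; nra.
split; first by rewrite big_split /= -!big_distrr /= a1 b1; ring.
move=> j; rewrite ae be !big_distrr -big_split /=.
by apply: eq_bigr => i _; ring.
Qed.

Lemma in_conv_barycenter n k (x : 'I_k -> pt n) (K : {set 'I_k}) : (0 < #|K|)%N ->
  in_conv x (barycenter x K).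
Proof.
move=> K0; have k0 := INR_gt0 K0.
exists (fun i => if i \in K then / INR #|K| else 0); split.
  by move=> i; case: ifP => _; [left; apply: Rinv_0_lt_compat | lra].
split; first by rewrite -big_mkcond (bigR_const K); field; lra.
move=> j; rewrite /barycenter big_distrr /= [LHS]big_mkcond.
by apply: eq_bigr => i _; case: ifP => _; ring.
Qed.

Lemma convex_jensen n k (x : 'I_k -> pt n) (f : pt n -> R) (m : nat)
    (c : 'I_m -> R) (p : 'I_m -> pt n) :
  convex_on (in_conv x) f -> (forall i, in_conv x (p i)) ->
  (forall i, 0 <= c i) -> \big[Rplus/0]_(i < m) c i = 1 ->
  in_conv x (fun j => \big[Rplus/0]_(i < m) (c i * p i j)) /\
  f (fun j => \big[Rplus/0]_(i < m) (c i * p i j)) <=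
    \big[Rplus/0]_(i < m) (c i * f (p i)).
Proof.
move=> hf; elim: m c p => [|m IH] c p hp c0; first by rewrite big_ord0; lra.
rewrite big_ord_recr /=; set t := c ord_max => c1.
pose c' i := c (widen_ord (leqnSn m) i); pose p' i := p (widen_ord (leqnSn m) i).
have S0 : 0 <= \big[Rplus/0]_(i < m) c' i by apply: bigR_ge0 => i _; apply: c0.
have t1 : \big[Rplus/0]_(i < m) c' i = 1 - t.
  by have c1' : \big[Rplus/0]_(i < m) c' i + t = 1 := c1; lra.
have t0 : 0 <= t by apply: c0.
(* If the last weight is 1, the others vanish and cannot be renormalized by [1 - t]. *)
case: (Req_dec t 1) => te.
  have cz i : c' i = 0.
    have le : c' i <= 1 - t.
      by rewrite -t1; apply: (@bigR_term_le _ c' i) => h; apply: c0.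
    by have := c0 (widen_ord (leqnSn m) i); rewrite -/(c' i); lra.
  have -> : (fun j => \big[Rplus/0]_(i < m.+1) (c i * p i j)) = p ord_max.
    apply: functional_extensionality => j; rewrite big_ord_recr /= -/t te big1.
      ring.
    by move=> i _; rewrite -/(c' i) cz; ring.
  split=> //; rewrite big_ord_recr /= -/t te big1; first lra.
  by move=> i _; rewrite -/(c' i) cz; ring.
have d0 : 0 < 1 - t by lra.
have [|| q1 q2] := IH (fun i => c' i / (1 - t)) p' (fun i => hp _).
- move=> i; apply: Rmult_le_pos; first exact: c0.
  by left; apply: Rinv_0_lt_compat.
- by rewrite /Rdiv -big_distrl /= t1; field; lra.
set q := fun j => _ in q1 q2.
have eF (F : pt n -> R) : \big[Rplus/0]_(i < m.+1) (c i * F (p i)) =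
    t * F (p ord_max) + (1 - t) * \big[Rplus/0]_(i < m) (c' i / (1 - t) * F (p' i)).
  rewrite big_ord_recr /= -/t big_distrr /= Rplus_comm; congr Rplus.
  by apply: eq_bigr => i _; rewrite -/(c' i) -/(p' i); field; lra.
have -> : (fun j => \big[Rplus/0]_(i < m.+1) (c i * p i j)) =
    fun j => t * p ord_max j + (1 - t) * q j.
  by apply: functional_extensionality => j; rewrite (eF (fun y => y j)).
split; first by apply: in_conv_comb => //; lra.
apply: Rle_trans (hf _ _ (hp _) q1 t _) _; first lra.
rewrite eF; apply: Rplus_le_compat_l; apply: Rmult_le_compat_l => //; lra.
Qed.

Lemma coordinates_line n k (x : 'I_k -> pt n) l i (p q : pt n) t :
  coordinates x l -> l i (fun j => p j + t * (q j - p j)) = l i p + t * (l i q - l i p).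
Proof.
case=> /(_ i) [a [A e]] _ _ _; rewrite !e.
have -> : \big[Rplus/0]_(j < n) (A j * (p j + t * (q j - p j))) =
  \big[Rplus/0]_(j < n) (A j * p j) +
  t * (\big[Rplus/0]_(j < n) (A j * q j) - \big[Rplus/0]_(j < n) (A j * p j)).
  rewrite -bigR_sub big_distrr -big_split /=; apply: eq_bigr => j _; ring.
ring.
Qed.

Lemma vertex_in_conv n k (x : 'I_k -> pt n) l i : coordinates x l -> in_conv x (x i).
Proof.
move=> X; apply/(in_convE _ X) => h; rewrite (coordinates_vertex _ _ X).
by case: eqP; lra.
Qed.

(** Jensen at the vertices bounds [f] above. For the lower bound, the barycenter [z] is placed
    between [y] and a point [w] of the simplex, and the upper bound is used at [w]. *)
Lemma convex_bounded n (x : 'I_n.+1 -> pt n) l f : coordinates x l ->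
  convex_on (in_conv x) f ->
  exists2 B, 0 <= B & forall y, in_conv x y -> Rabs (f y) <= B.
Proof.
move=> X hf; have [_ S Bd _] := X.
pose M := \big[Rplus/0]_(i < n.+1) Rabs (f (x i)).
have M0 : 0 <= M by apply: bigR_ge0 => i _; apply: Rabs_pos.
have upper y : in_conv x y -> f y <= M.
  move=> /(in_convE _ X) hy.
  have [_] := convex_jensen hf (fun i => vertex_in_conv i X) hy (S y).
  have -> : (fun j => \big[Rplus/0]_(i < n.+1) (l i y * x i j)) = y.
    by apply: functional_extensionality => j; rewrite -Bd.
  move/Rle_trans; apply; apply: bigR_le => i _.
  have := Rle_abs (f (x i)); have := Rabs_pos (f (x i)); have := hy i.
  by have := coordinates_ge0_le1 i X hy; nra.
pose k := INR n.+1; have k1 : 1 <= k by rewrite /k S_INR; have := pos_INR n; lra.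
pose z := barycenter x [set: 'I_n.+1].
have hz : in_conv x z by apply: in_conv_barycenter; rewrite cardsT card_ord.
have zE j : z j = \big[Rplus/0]_(i < n.+1) (/ k * x i j).
  rewrite /z /barycenter cardsT card_ord -big_distrr /=; congr Rmult.
  by apply: eq_bigl => i; rewrite inE.
exists (M + 2 * k * (Rabs (f z) + M)) => [|y hy].
  by have := Rabs_pos (f z); nra.
have yl := (in_convE y X).1 hy.
(* Small enough that the weights [1/k - t * l i y] of [w] are nonnegative and that [1 - t] is
   positive. *)
pose t := / (2 * k).
have tk : t * (2 * k) = 1 by rewrite /t; field; lra.
have t0 : 0 < t by apply: Rinv_0_lt_compat; lra.
have t1 : t <= / 2 by apply: Rinv_le_contravar; lra.
have ik : / k = 2 * t by rewrite /t; field; lra.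
pose w j := (z j - t * y j) / (1 - t).
have hw : in_conv x w.
  exists (fun i => (/ k - t * l i y) / (1 - t)); split; last split.
  - move=> i; apply: Rmult_le_pos; last by left; apply: Rinv_0_lt_compat; lra.
    by have := coordinates_ge0_le1 i X yl; rewrite ik; nra.
  - rewrite /Rdiv -big_distrl /= bigR_sub -big_distrr /= S bigR_const_ord -/k.
    by field; lra.
  - move=> j; rewrite /w zE {1}(Bd y j) big_distrr -bigR_sub /Rdiv big_distrl /=.
    by apply: eq_bigr => i _; ring.
have := hf y w hy hw t ltac:(lra).
have -> : (fun j => t * y j + (1 - t) * w j) = z.
  by apply: functional_extensionality => j; rewrite /w; field; lra.
have uw := upper w hw; have uy := upper y hy => fz.
have fzM : - Rabs (f z) <= f z by have := Rle_abs (- f z); rewrite Rabs_Ropp; lra.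
have z0 := Rabs_pos (f z).
have : - (Rabs (f z) + M) <= t * f y by nra.
move=> h; have : - (Rabs (f z) + M) * (2 * k) <= f y.
  have -> : f y = t * f y * (2 * k) by rewrite -[LHS]Rmult_1_l -tk; ring.
  by apply: Rmult_le_compat_r; lra.
move=> h2; apply: Rabs_le; split; first by nra.
have : 0 <= 2 * k * (Rabs (f z) + M) by apply: Rmult_le_pos; lra.
lra.
Qed.

(* Extend the segment from [y] through [z] until the simplex is left, and apply
   convexity on the longer segment. *)
Lemma convex_lip_on n k (x : 'I_k -> pt n) l f B e : coordinates x l ->
  convex_on (in_conv x) f -> (forall y, in_conv x y -> Rabs (f y) <= B) ->
  0 <= B -> 0 < e ->
  exists2 K, 0 <= K & lip_on (fun y => forall i, e <= l i y) K f.
Proof.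
move=> X hf hB B0 e0; have [_ _ Bd _] := X.
have [i a b ab h r y z r0 _ _ c|i|K K0 hK] :=
    @common_bound _ (fun (i : 'I_k) K => lip_on (fun _ => True) K (l i)).
- by apply: Rle_trans (h r y z r0 I I c) _; apply: Rmult_le_compat_r.
- exact: coordinates_lip X.
exists (2 * B * K / e) => [|r y0 z0 r0 hy0 hz0 c0].
  by apply: Rmult_le_pos; [nra | left; apply: Rinv_0_lt_compat].
have conv y : (forall i, e <= l i y) -> in_conv x y.
  by move=> h; apply/(in_convE _ X) => i; have := h i; lra.
have half y z : (forall i, e <= l i y) -> (forall i, e <= l i z) ->
    cube_close r y z -> f z - f y <= 2 * B * K / e * r.
  move=> hy hz c.
  have cl i : Rabs (l i y - l i z) <= K * r by apply: hK.
  have r_ge0 : 0 <= K * r by apply: Rmult_le_pos.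
  (* With [K * r = 0] the coordinates agree, so [z = y], and the extension factor below would be
     undefined. *)
  case: (Req_dec (K * r) 0) => rho0.
    have -> : z = y.
      apply: functional_extensionality => j; rewrite (Bd y) (Bd z).
      apply: eq_bigr => i _; congr Rmult; have := cl i; rewrite rho0.
      have := Rle_abs (l i y - l i z); have := Rle_abs (- (l i y - l i z)).
      by rewrite Rabs_Ropp; lra.
    have -> : 2 * B * K / e * r = 2 * B / e * (K * r) by field; lra.
    by rewrite rho0; lra.
  have rho : 0 < K * r by lra.
  (* Each coordinate of [z] is at least [e] and drops by at most [s * (K * r) = e] on the way to
     [w], so [w] is still in the simplex. *)
  pose s := e / (K * r).
  have s0 : 0 < s by apply: Rmult_lt_0_compat => //; apply: Rinv_0_lt_compat.
  have sr : s * (K * r) = e by rewrite /s; field; nra.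
  pose w j := z j + (- s) * (y j - z j).
  have hw : in_conv x w.
    apply/(in_convE _ X) => i; rewrite (coordinates_line _ _ _ _ X).
    have := hz i; have := Rle_abs (l i y - l i z); have := cl i => h1 h2 h3.
    have : s * (l i y - l i z) <= e by rewrite -sr; apply: Rmult_le_compat_l; lra.
    lra.
  have th0 : 0 < / (1 + s) by apply: Rinv_0_lt_compat; lra.
  have th1 : / (1 + s) <= 1 by rewrite -Rinv_1; apply: Rinv_le_contravar; lra.
  have := hf w y hw (conv y hy) (/ (1 + s)) ltac:(lra).
  have -> : (fun j => / (1 + s) * w j + (1 - / (1 + s)) * y j) = z.
    by apply: functional_extensionality => j; rewrite /w; field; lra.
  move=> fz; have := hB w hw; have := hB y (conv y hy).
  have := Rle_abs (f w); have := Rle_abs (- f y); rewrite Rabs_Ropp => a1 a2 a3 a4.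
  have h1 : f z - f y <= / (1 + s) * (2 * B) by nra.
  apply: Rle_trans h1 _.
  have -> : 2 * B * K / e * r = / s * (2 * B) by rewrite /s; field; nra.
  apply: Rmult_le_compat_r; first lra.
  by apply: Rinv_le_contravar; lra.
apply: Rabs_le; split.
- have := half z0 y0 hz0 hy0 (cube_close_sym c0); have := half y0 z0 hy0 hz0 c0; lra.
- exact: half hz0 hy0 (cube_close_sym c0).
Qed.

(** The bumps live at depth [d/(n+1)], where [f] is Lipschitz. They also vanish outside the simplex,
    where [f] is arbitrary. *)
Lemma convex_approx n (x : 'I_n.+1 -> pt n) l f : coordinates x l ->
  convex_on (in_conv x) f ->
  exists2 B, 0 <= B & forall d, 0 < d ->
    lip (fun y => f y * flag_bumps d l y) /\
    forall y, Rabs (restrict (in_conv x) f y - f y * flag_bumps d l y) <=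
              B * flag_slabs d l y.
Proof.
move=> X hf; have [B B0 hB] := convex_bounded X hf.
exists B => // d d0; have k0 : 0 < INR n.+1 by apply: INR_gt0.
have dk : 0 < d / INR n.+1 by apply: Rmult_lt_0_compat => //; apply: Rinv_0_lt_compat.
have supp y : flag_bumps d l y <> 0 -> in_conv x y.
  move=> h; apply/(in_convE _ X) => i; have := flag_bumps_supp d0 h i; lra.
split.
  have [K K0 hK] := convex_lip_on X hf hB B0 dk.
  apply: (@lip_mul_supp n f _ K B 1) => //; last exact: lip_flag_bumps X.
  - by move=> r y z r0 hy hz c; apply: hK => //; apply: flag_bumps_supp.
  - by move=> y /supp /hB.
  - by move=> y; rewrite Rabs_pos_eq; have := flag_bumps_01 l y d0; lra.
move=> y; have psi0 := flag_slabs_ge0 d l y.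
rewrite /restrict; case: excluded_middle_informative => hy.
  have -> : f y - f y * flag_bumps d l y = f y * (1 - flag_bumps d l y) by ring.
  rewrite Rabs_mult; apply: Rmult_le_compat; try exact: Rabs_pos; first exact: hB.
  by apply: flag_bumps_approx => //; apply/(in_convE _ X).
have -> : flag_bumps d l y = 0.
  by case: (Req_dec (flag_bumps d l y) 0) => // /supp.
by rewrite Rmult_0_r Rminus_0_r Rabs_R0; apply: Rmult_le_pos.
Qed.

Lemma convex_integrable n L (x : 'I_n.+1 -> pt n) l f : (0 < n)%N ->
  coordinates x l -> (forall i j, Rabs (x i j) < INR L) ->
  convex_on (in_conv x) f ->
  exists v C : R, [/\ 0 <= C, riemann_integral L (restrict (in_conv x) f) v
    & forall d, 0 < d ->
        Rabs (v - integ L (fun y => f y * flag_bumps d l y)) <= C * d].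
Proof.
move=> n0 X box hf; have [B B0 hB] := convex_approx X hf.
have [C C0 hC] := integ_flag_slabs L n0 X.
have lpsi d : lip (flag_slabs d l) by apply: lip_flag_slabs X.
have bound d : 0 < d -> integ L (fun y => B * flag_slabs d l y) <= B * C * d.
  move=> d0; rewrite integ_scal //; have := hC d d0; nra.
have BC : 0 <= B * C by apply: Rmult_le_pos.
have [|v hv] := @sandwich_integrable n L (restrict (in_conv x) f).
  (* The added 1 keeps the denominator positive when [B * C = 0]. *)
  move=> eps eps0; pose d := eps / (B * C + 1).
  have d0 : 0 < d by apply: Rmult_lt_0_compat => //; apply: Rinv_0_lt_compat; lra.
  exists (fun y => f y * flag_bumps d l y), (fun y => B * flag_slabs d l y).
  have [h1 h2] := hB d d0; split=> //; first exact: lip_scal.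
  apply: Rle_trans (bound d d0) _.
  have : d * (B * C + 1) = eps by rewrite /d; field; lra.
  nra.
exists v, (B * C); split=> //.
- split=> // y [j hj]; rewrite /restrict; case: excluded_middle_informative => // hy.
  have [eta eta0 margin] := simplex_margin X box.
  by have := margin y ((in_convE y X).1 hy) j; lra.
- move=> d d0; have [h1 h2] := hB d d0; apply: Rle_trans (bound d d0).
  by apply: riemann_cv_dist hv h1 (lip_scal B (lpsi d)) h2.
Qed.

(** The vertex map of [s^-1] replaces coordinate [h] by coordinate [s h], hence turns the flag bump
    of the identity into that of [s]. *)
Lemma integ_flag_bump n L d (x : 'I_n.+1 -> pt n) l s : coordinates x l ->
  (forall i j, Rabs (x i j) < INR L) -> 0 < d -> 2 * d <= / INR n.+1 ->
  integ L (simplex_bump d (flag_coord l s)) = integ L (simplex_bump d (flag_coord l 1%g)).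
Proof.
move=> X box d0 hd; have X1 := flag_coordinates 1%g X.
have k0 : 0 < INR n.+1 by apply: INR_gt0.
rewrite -[RHS](@integ_vertex_map n L x l s^-1%g _ (simplex_bump d l) X) //.
- apply: integ_ext => y; apply: eq_bigr => i _; congr (clamp (_ / _ - 1)).
  have e h : l ((1%g : {perm 'I_n.+1}) h) (vertex_map x l s^-1%g y) = l (s h) y.
    by rewrite (vertex_map_coord _ _ _ X) invgK perm1.
  rewrite /flag_coord e; congr (_ * (_ - _)).
  by rewrite /ord_ext; case: insubP => [h _ _|_] //=; rewrite e.
- exact: lip_bump X1.
- move=> y hy i; have fl := bump_supp d0 hy.
  have := @flag_coord_ge n n.+1 l 1%g y 0 (Rle_refl 0)
    (fun i => Rlt_le _ _ (Rlt_trans _ _ _ d0 (fl i))) i.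
  by rewrite /Rdiv Rmult_0_l.
- exact: lip_bump X.
- by move=> y; apply: bump_supp_ge0.
- by move=> y; apply: bump_vertex_map.
- exact: integ_bump_gt0 X box d0 hd.
Qed.

Lemma flag_box n L (x : 'I_n.+1 -> pt n) l s : coordinates x l ->
  (forall i j, Rabs (x i j) < INR L) -> forall i j, Rabs (flag x s i j) < INR L.
Proof.
move=> X box i j; have [eta eta0 margin] := simplex_margin X box.
have : in_conv x (flag x s i) by apply: in_conv_barycenter; rewrite card_flag_face.
by move=> /(in_convE _ X) h; have := margin _ h j; lra.
Qed.

Lemma integ_flag_bumps_gt0 n L d (x : 'I_n.+1 -> pt n) l : coordinates x l ->
  (forall i j, Rabs (x i j) < INR L) -> 0 < d -> 2 * d <= / INR n.+1 ->
  0 < integ L (flag_bumps d l).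
Proof.
move=> X box d0 hd.
have pos s : 0 < integ L (simplex_bump d (flag_coord l s)).
  exact: integ_bump_gt0 (flag_coordinates s X) (flag_box s X box) d0 hd.
rewrite /flag_bumps integ_sum => [|s]; last exact: lip_bump (flag_coordinates s X).
apply: Rlt_le_trans (pos 1%g) _.
apply: (@bigR_term_le _ (fun s => integ L (simplex_bump d (flag_coord l s)))) => s.
exact: Rlt_le.
Qed.

Lemma integ_convex_le n L d (x : 'I_n.+1 -> pt n) l f : coordinates x l ->
  (forall i j, Rabs (x i j) < INR L) -> convex_on (in_conv x) f ->
  0 < d -> 2 * d <= / INR n.+1 ->
  integ L (fun y => f y * flag_bumps d l y) <=
  (/ INR n.+1 * \big[Rplus/0]_(1 <= k < n.+2)
     (/ INR 'C(n.+1, k) *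
      \big[Rplus/0]_(K : {set 'I_n.+1} | #|K| == k) f (barycenter x K))) *
  integ L (flag_bumps d l).
Proof.
move=> X box hf d0 hd; have k0 : 0 < INR n.+1 by apply: INR_gt0.
pose J := integ L (simplex_bump d (flag_coord l 1%g)).
have Fl s := flag_coordinates s X.
have conv s i : in_conv x (flag x s i) by apply: in_conv_barycenter; rewrite card_flag_face.
pose w s i y := flag_coord l s i y * simplex_bump d (flag_coord l s) y.
have lw s i : lip (w s i) by apply: lip_coord_bump (Fl s) d0.
have Jw s i : integ L (w s i) = / INR n.+1 * J.
  by rewrite (integ_coord_bump _ (Fl s) (flag_box s X box) d0 hd) (integ_flag_bump s X box d0 hd).
have JE : integ L (flag_bumps d l) = INR #|{perm 'I_n.+1}| * J.
  rewrite /flag_bumps integ_sum => [|s]; last exact: lip_bump (Fl s).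
  rewrite (eq_bigr (fun=> J)) => [|s _]; last exact: integ_flag_bump X box d0 hd.
  by rewrite (bigR_const {: {perm 'I_n.+1}}).
(* On each small simplex, the affine interpolation of [f] at the flag vertices, damped by the bump;
   Jensen makes it an upper bound. *)
pose u y := \big[Rplus/0]_(s : {perm 'I_n.+1}) \big[Rplus/0]_(i < n.+1) (f (flag x s i) * w s i y).
have ls s : lip (fun y => \big[Rplus/0]_(i < n.+1) (f (flag x s i) * w s i y)).
  by apply: lip_sum => i; apply: lip_scal.
have lu : lip u by apply: lip_sum.
have [B _ /(_ d d0) [lfE _]] := convex_approx X hf.
apply: Rle_trans (integ_le L lfE lu _) _.
  move=> y; rewrite /u /flag_bumps big_distrr /=; apply: bigR_le => s _.
  case: (Req_dec (simplex_bump d (flag_coord l s) y) 0) => e.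
    by rewrite e big1 => [|i _]; [lra | rewrite /w e; ring].
  have [_ S Bd _] := Fl s.
  have [_] := convex_jensen hf (conv s) (bump_supp_ge0 d0 e) (S y).
  have -> : (fun j => \big[Rplus/0]_(i < n.+1) (flag_coord l s i y * flag x s i j)) = y.
    by apply: functional_extensionality => j; rewrite -Bd.
  move=> h; have b0 := (bump_01 d (flag_coord l s) y).1.
  apply: Rle_trans (Rmult_le_compat_r _ _ _ b0 h) _.
  by rewrite big_distrl /=; right; apply: eq_bigr => i _; rewrite /w; ring.
right; rewrite /u integ_sum //.
transitivity (\big[Rplus/0]_(s : {perm 'I_n.+1}) \big[Rplus/0]_(i < n.+1)
    (/ INR n.+1 * J * f (flag x s i))).
  apply: eq_bigr => s _; rewrite integ_sum => [|i]; last exact: lip_scal.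
  by apply: eq_bigr => i _; rewrite integ_scal // Jw; ring.
(* The index shift matches flag position [i] with faces of cardinality [k = i.+1]. *)
rewrite exchange_big JE big_add1 big_mkord /= big_distrr big_distrl /=.
apply: eq_bigr => i _; rewrite -big_distrr /=.
have := flag_face_sum i (fun K => f (barycenter x K)).
rewrite /flag; set A := \big[_/_]_(s : {perm _}) _; set D := \big[_/_]_(K | _) _.
set N := INR #|_|; have c0 : 0 < INR 'C(n.+1, i.+1).
  by apply: INR_gt0; rewrite bin_gt0 ltn_ord.
set c := INR _ in c0 * => e.
have -> : A = / c * (N * D) by rewrite -e; field; lra.
rewrite -/(INR n.+1); ring.
Qed.

(* Avg(f, Delta) = I / V where I = integral of f over Delta and V = Vol(Delta);
   L is any size of a box (-L, L)^n containing the simplex. *)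
Theorem theorem9 (n : nat) (hn : (1 <= n)%N) (x : 'I_n.+1 -> pt n)
  (hx : affinely_independent x) (f : pt n -> R)
  (hf : convex_on (in_conv x) f)
  (L : nat) (hL : forall (i : 'I_n.+1) (j : 'I_n), Rabs (x i j) < INR L) :
  exists I V : R,
    riemann_integral L (restrict (in_conv x) f) I /\
    riemann_integral L (restrict (in_conv x) (fun _ => 1)) V /\
    0 < V /\
    I / V <=
      / INR n.+1 *
      \big[Rplus/0]_(1 <= k < n.+2)
        (/ INR 'C(n.+1, k) *
         \big[Rplus/0]_(K : {set 'I_n.+1} | #|K| == k) f (barycenter x K)).
Proof.
have [l X] := coordinates_exist hx.
have [I [C [C0 hI dI]]] := convex_integrable hn X hL hf.
(* The volume is treated as the integral of a convex function, with the same bumps and the same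
   [O(d)] error. *)
have cst : convex_on (in_conv x) (fun=> 1) by move=> y z _ _ t _; lra.
have [V [C' [C'0 hV dV]]] := convex_integrable hn X hL cst.
have eE d : integ L (fun y => 1 * flag_bumps d l y) = integ L (flag_bumps d l).
  by apply: integ_ext => y; ring.
exists I, V; split=> //; split=> //.
have k0 : 0 < / INR n.+1 by apply/Rinv_0_lt_compat/INR_gt0.
have V0 : 0 < V.
  pose d := / INR n.+1 / 2; have d0 : 0 < d by rewrite /d; lra.
  have d1 : 2 * d <= / INR n.+1 by rewrite /d; lra.
  have := integ_flag_bumps_gt0 X hL d0 d1.
  move/Rlt_le_trans; apply.
  refine (lim_seq_pos_le _ (lip_cv L (lip_flag_bumps d X)) (riemann_cv_corner hV.2)) => m m0.
  apply: riemann_sum_le => // c; rewrite /restrict.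
  have := flag_bumps_01 l (corner c) d0.
  case: excluded_middle_informative => [ins|out] /= h01; first lra.
  case: (Req_dec (flag_bumps d l (corner c)) 0) => [->|h]; first lra.
  case: out; apply/(in_convE _ X) => i.
  apply: Rle_trans (flag_bumps_supp d0 h i).
  by apply: Rmult_le_pos; lra.
split=> //; set Q := / INR n.+1 * _.
suff : I <= Q * V.
  by move=> h; apply: (Rmult_le_reg_r V) => //; field_simplify; lra.
apply: le_epsilon => eps eps0.
(* Replacing [I] costs [C * d] and replacing [V] costs [|Q| * C' * d], as [Q] may have either sign;
   the 1 keeps [D] positive. *)
pose D := C + Rabs Q * C' + 1.
have Q0 := Rabs_pos Q.
have QC : 0 <= Rabs Q * C' by apply: Rmult_le_pos.
have D0 : 0 < D by rewrite /D; lra.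
pose d := Rmin (eps / D) (/ INR n.+1 / 2).
have eD : 0 < eps / D by apply: Rmult_lt_0_compat => //; apply: Rinv_0_lt_compat.
have d0 : 0 < d by apply: Rmin_glb_lt; lra.
have d1 : 2 * d <= / INR n.+1 by have := Rmin_r (eps / D) (/ INR n.+1 / 2); rewrite -/d; lra.
have d2 : d * D <= eps.
  have := Rmin_l (eps / D) (/ INR n.+1 / 2); rewrite -/d => h.
  have -> : eps = eps / D * D by field; lra.
  by apply: Rmult_le_compat_r; lra.
have := integ_convex_le X hL hf d0 d1; rewrite -/Q.
have := dI d d0; have := dV d d0; rewrite eE.
set E := integ L (flag_bumps d l); set F := integ L _ => h1 h2 h3.
have h4 := Rle_trans _ _ _ (Rle_abs _) h2.
have h5 : Q * (E - V) <= Rabs Q * (C' * d).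
  apply: Rle_trans (Rle_abs _) _; rewrite Rabs_mult Rabs_minus_sym.
  exact: Rmult_le_compat_l.
rewrite /D in d2; nra.
Qed.
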